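(* The quasivariety of $\mathcal{L}'$-local $\mathcal{L}$-unimodal algebras is generated as a universal class by the class of all complex algebras of $\mathcal{L}'$-local $\mathcal{L}$-unimodal frames.
   Context: $\mathcal{L}\subseteq\{\Box_+,\Box_-,\Diamond_+,\Diamond_-\}$ is a set of forward modalities on bounded distributive lattices ($\Box_+$ preserves finite meets; $\Diamond_+$ finite joins; $\Box_-(a\vee b)=\Box_-a\wedge\Box_-b$, $\Box_-\bot=\top$; $\Diamond_-(a\wedge b)=\Diamond_-a\vee\Diamond_-b$, $\Diamond_-\top=\bot$). Backward modalities are written $\overleftarrow{\Box}_\alpha,\overleftarrow{\Diamond}_\alpha$; the adjoint pairs are $(\Box_+,\overleftarrow{\Diamond}_+)$, $(\Diamond_+,\overleftarrow{\Box}_+)$, $(\Box_-,\overleftarrow{\Box}_-)$, $(\Diamond_-,\overleftarrow{\Diamond}_-)$. $\mathcal{L}'$ is a set of forward and/or backward modalities, each a modality of $\mathcal{L}$ or adjoint to one in $\mathcal{L}$. An $\mathcal{L}$-unimodal algebra is an $\mathcal{L}$-modal algebra satisfying, for all pairs of modalities in $\mathcal{L}$, the quasiequations: $\Box_-a\wedge\Box_+(a\vee b)\le\Box_+b$; $\Box_+a\wedge\Box_-(a\wedge b)\le\Box_-b$; $\Diamond_+b\le\Diamond_+(a\wedge b)\vee\Diamond_-a$; $\Diamond_-b\le\Diamond_-(a\vee b)\vee\Diamond_+a$; $\Diamond_-a\wedge c\le\Box_+a\Rightarrow c\le\Box_+a$; $\Diamond_+a\wedge c\le\Box_-a\Rightarrow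 c\le\Box_-a$; $\Diamond_+a\le\Box_-a\vee c\Rightarrow\Diamond_+a\le c$; $\Diamond_-a\le\Box_+a\vee c\Rightarrow\Diamond_-a\le c$; $\Diamond_+b\wedge c\le\Box_+a\Rightarrow\Box_+(a\vee b)\wedge c\le\Box_+a$; $\Diamond_-b\wedge c\le\Box_-a\Rightarrow\Box_-(a\wedge b)\wedge c\le\Box_-a$; $\Diamond_+a\le\Box_+b\vee c\Rightarrow\Diamond_+a\le\Diamond_+(a\wedge b)\vee c$; $\Diamond_-a\le\Box_-b\vee c\Rightarrow\Diamond_-a\le\Diamond_-(a\vee b)\vee c$. An $\mathcal{L}$-unimodal frame is a poset $(W,\le)$ with a relation $R$ generating $R^\Box_+={\le}\circ R\circ{\le}$, $R^\Diamond_+={\ge}\circ R\circ{\ge}$, $R^\Box_-={\le}\circ R\circ{\ge}$, $R^\Diamond_-={\ge}\circ R\circ{\le}$ for the modalities in $\mathcal{L}$ (with $R=\bigcap R^\Delta_\alpha$); its complex algebra is the (bi-Heyting) lattice of upsets with $\Box_+a=\{u:uR^\Box_+v\Rightarrow v\in a\}$, $\Box_-a=\{u:uR^\Box_-v\Rightarrow v\notin a\}$, $\Diamond_+a=\{u:\exists v\in a,uR^\Diamond_+v\}$, $\Diamond_-a=\{u:\exists v\notin a,uR^\Diamond_-v\}$. Locality frame conditions: $(\Diamond_+)^*$: ${\ge}\circ R\subseteq R\circ{\ge}$; $(\Diamond_-)^*$: ${\ge}\circ R\subseteq R\circ{\le}$; $(\Box_+)^*$: ${\le}\circ R\subseteq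 R\circ{\le}$; $(\Box_-)^*$: ${\le}\circ R\subseteq R\circ{\ge}$; $(\overleftarrow{\Diamond}_+)^*$: $R\circ{\le}\subseteq{\le}\circ R$; $(\overleftarrow{\Diamond}_-)^*$: $R\circ{\le}\subseteq{\ge}\circ R$; $(\overleftarrow{\Box}_+)^*$: $R\circ{\ge}\subseteq{\ge}\circ R$; $(\overleftarrow{\Box}_-)^*$: $R\circ{\ge}\subseteq{\le}\circ R$. An $\mathcal{L}'$-local $\mathcal{L}$-unimodal frame satisfies $(\Delta_\alpha)^*$ for each $\Delta_\alpha\in\mathcal{L}'$. Algebraic locality equations ($\rightarrow$ Heyting implication, $-$ co-implication): $(\Diamond_+,\Box_+)^*$: $\Box_+a\wedge\Diamond_+b\le\Diamond_+(a\wedge b)$; $(\Diamond_-,\Box_-)^*$: $\Box_-a\wedge\Diamond_-b\le\Diamond_-(a\vee b)$; $(\Box_+,\Diamond_+)^*$: $\Box_+(a\vee b)\le\Box_+a\vee\Diamond_+b$; $(\Box_-,\Diamond_-)^*$: $\Box_-(a\wedge b)\le\Box_-a\vee\Diamond_-b$; $(\Diamond_+,\Box_-)^*$: $\Box_-a\wedge\Diamond_+a\le\bot$; $(\Diamond_-,\Box_+)^*$: $\Box_+a\wedge\Diamond_-a\le\bot$; $(\Box_+,\Diamond_-)^*$: $\top\le\Box_+a\vee\Diamond_-a$; $(\Box_-,\Diamond_+)^*$: $\top\le\Box_-a\vee\Diamond_+a$; $(\overleftarrow{\Diamond}_+,\overleftarrow{\Box}_+)^*$: $\Diamond_+a\rightarrow\Box_+b\le\Box_+(a\rightarrow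 b)$; $(\overleftarrow{\Diamond}_-,\overleftarrow{\Box}_-)^*$: $\Diamond_-(a\rightarrow b)\le\Diamond_-b-\Box_-a$; $(\overleftarrow{\Box}_+,\overleftarrow{\Diamond}_+)^*$: $\Diamond_+(b-a)\le\Diamond_+b-\Box_+a$; $(\overleftarrow{\Box}_-,\overleftarrow{\Diamond}_-)^*$: $\Diamond_-a\rightarrow\Box_-b\le\Box_-(b-a)$; $(\overleftarrow{\Diamond}_+,\overleftarrow{\Box}_-)^*$: $\Box_-a\le\Box_+(a\rightarrow\bot)$; $(\overleftarrow{\Diamond}_-,\overleftarrow{\Box}_+)^*$: $\Diamond_-(a\rightarrow\bot)\le\Diamond_+a$; $(\overleftarrow{\Box}_+,\overleftarrow{\Diamond}_-)^*$: $\Diamond_+(\top-a)\le\Diamond_-a$; $(\overleftarrow{\Box}_-,\overleftarrow{\Diamond}_+)^*$: $\Box_+a\le\Box_-(\top-a)$. An algebra satisfies $(\Delta_\alpha)^*$ if it satisfies $(\Delta_\alpha,\nabla_\alpha)^*$ and $(\Delta_\alpha,\nabla_{-\alpha})^*$ whenever the modalities these equations involve are available ($\nabla$ the opposite symbol: $\Box\leftrightarrow\Diamond$, $\overleftarrow{\Box}\leftrightarrow\overleftarrow{\Diamond}$; the backward equations involve the forward modalities adjoint to the backward symbols), and it is appropriate for $(\Delta_\alpha)^*$ if it is a Heyting/co-Heyting/bi-Heyting algebra as required by the connectives of those equations. An $\mathcal{L}'$-local $\mathcal{L}$-unimodal algebra is an $\mathcal{L}$-unimodal algebra appropriate for and satisfying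 $(\Delta_\alpha)^*$ for each $\Delta_\alpha\in\mathcal{L}'$. *)

(* Defs.v *)
From Stdlib Require Import Bool List Relations.
Import ListNotations.

Set Implicit Arguments.
Coercion is_true : bool >-> Sortclass.

(** * Modalities *)

Inductive sign := pos | neg.
Inductive fmod := box (s : sign) | dia (s : sign).

(** [bwd (box s)] and [bwd (dia s)] are the backward modalities written with
    the symbols box and diamond of sign [s]. *)
Inductive modality := fwd (m : fmod) | bwd (m : fmod).

Definition adjoint (m : fmod) : fmod :=
  match m with
  | box pos => dia pos
  | dia pos => box pos
  | box neg => box neg
  | dia neg => dia neg
  end.

(** The forward modality which must be present for a given modality to make
    sense: itself, or the forward adjoint of a backward modality. *)
Definition base (m : modality) : fmod :=
  match m with fwd m => m | bwd m => adjoint m end.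

Definition opposite (m : modality) (s : sign) : modality :=
  match m with
  | fwd (box _) => fwd (dia s)
  | fwd (dia _) => fwd (box s)
  | bwd (box _) => bwd (dia s)
  | bwd (dia _) => bwd (box s)
  end.

(** * Signatures and algebras *)

Record signature := Signature {
  modals : fmod -> bool;
  has_imp : bool;
  has_coimp : bool
}.

(** An arbitrary first-order structure of the given signature; an operation
    exists only if its symbol belongs to the signature. *)
Record algebra (S : signature) := Algebra {
  carrier :> Type;
  bot : carrier;
  top : carrier;
  meet : carrier -> carrier -> carrier;
  join : carrier -> carrier -> carrier;
  imp : has_imp S -> carrier -> carrier -> carrier;
  coimp : has_coimp S -> carrier -> carrier -> carrier;
  modal : forall m : fmod, modals S m -> carrier -> carrier
}.
Arguments bot {S a}.
Arguments top {S a}.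
Arguments meet {S a}.
Arguments join {S a}.
Arguments imp {S a}.
Arguments coimp {S a}.
Arguments modal {S} a m.

Definition leq {S} {A : algebra S} (a b : A) : Prop := meet a b = a.

Notation "a ⊓ b" := (meet a b) (at level 40, left associativity).
Notation "a ⊔ b" := (join a b) (at level 50, left associativity).
Notation "a ⊑ b" := (leq a b) (at level 70, no associativity).

Record bounded_distributive_lattice {S} (A : algebra S) : Prop := {
  meetA : forall a b c : A, a ⊓ (b ⊓ c) = a ⊓ b ⊓ c;
  meetC : forall a b : A, a ⊓ b = b ⊓ a;
  joinA : forall a b c : A, a ⊔ (b ⊔ c) = a ⊔ b ⊔ c;
  joinC : forall a b : A, a ⊔ b = b ⊔ a;
  meet_join_absorb : forall a b : A, a ⊓ (a ⊔ b) = a;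
  join_meet_absorb : forall a b : A, a ⊔ (a ⊓ b) = a;
  meet_join_distr : forall a b c : A, a ⊓ (b ⊔ c) = (a ⊓ b) ⊔ (a ⊓ c);
  join_bot : forall a : A, a ⊔ bot = a;
  meet_top : forall a : A, a ⊓ top = a
}.

Definition when1 {S} (A : algebra S) (m : fmod) (P : (A -> A) -> Prop) : Prop :=
  forall h : modals S m, P (modal A m h).

Definition when2 {S} (A : algebra S) (m n : fmod)
    (P : (A -> A) -> (A -> A) -> Prop) : Prop :=
  forall (h : modals S m) (k : modals S n), P (modal A m h) (modal A n k).

Record modal_algebra {S} (A : algebra S) : Prop := {
  modal_lattice : bounded_distributive_lattice A;
  box_pos : when1 A (box pos) (fun B =>
    (forall a b, B (a ⊓ b) = B a ⊓ B b) /\ B top = top);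
  dia_pos : when1 A (dia pos) (fun D =>
    (forall a b, D (a ⊔ b) = D a ⊔ D b) /\ D bot = bot);
  box_neg : when1 A (box neg) (fun B =>
    (forall a b, B (a ⊔ b) = B a ⊓ B b) /\ B bot = top);
  dia_neg : when1 A (dia neg) (fun D =>
    (forall a b, D (a ⊓ b) = D a ⊔ D b) /\ D top = bot)
}.

(** In the names of bound operations, a prime marks negative sign. *)
Record unimodal_algebra {S} (A : algebra S) : Prop := {
  unimodal_modal : modal_algebra A;
  unimodal1 : when2 A (box neg) (box pos) (fun B' B =>
    forall a b, B' a ⊓ B (a ⊔ b) ⊑ B b);
  unimodal2 : when2 A (box pos) (box neg) (fun B B' =>
    forall a b, B a ⊓ B' (a ⊓ b) ⊑ B' b);
  unimodal3 : when2 A (dia pos) (dia neg) (fun D D' =>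
    forall a b, D b ⊑ D (a ⊓ b) ⊔ D' a);
  unimodal4 : when2 A (dia neg) (dia pos) (fun D' D =>
    forall a b, D' b ⊑ D' (a ⊔ b) ⊔ D a);
  unimodal5 : when2 A (dia neg) (box pos) (fun D' B =>
    forall a c, D' a ⊓ c ⊑ B a -> c ⊑ B a);
  unimodal6 : when2 A (dia pos) (box neg) (fun D B' =>
    forall a c, D a ⊓ c ⊑ B' a -> c ⊑ B' a);
  unimodal7 : when2 A (dia pos) (box neg) (fun D B' =>
    forall a c, D a ⊑ B' a ⊔ c -> D a ⊑ c);
  unimodal8 : when2 A (dia neg) (box pos) (fun D' B =>
    forall a c, D' a ⊑ B a ⊔ c -> D' a ⊑ c);
  unimodal9 : when2 A (dia pos) (box pos) (fun D B =>
    forall a b c, D b ⊓ c ⊑ B a -> B (a ⊔ b) ⊓ c ⊑ B a);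
  unimodal10 : when2 A (dia neg) (box neg) (fun D' B' =>
    forall a b c, D' b ⊓ c ⊑ B' a -> B' (a ⊓ b) ⊓ c ⊑ B' a);
  unimodal11 : when2 A (dia pos) (box pos) (fun D B =>
    forall a b c, D a ⊑ B b ⊔ c -> D a ⊑ D (a ⊓ b) ⊔ c);
  unimodal12 : when2 A (dia neg) (box neg) (fun D' B' =>
    forall a b c, D' a ⊑ B' b ⊔ c -> D' a ⊑ D' (a ⊔ b) ⊔ c)
}.

(** * Algebraic locality *)

(** [locality_eq A m s] is the equation attached to [m] and [opposite m s],
    imposed if the modalities involved are available in the signature. *)
Definition locality_eq {S} (A : algebra S) (m : modality) (s : sign) : Prop :=
  match m, s with
  | fwd (dia pos), pos => when2 A (box pos) (dia pos) (fun B D =>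
      forall a b, B a ⊓ D b ⊑ D (a ⊓ b))
  | fwd (dia neg), neg => when2 A (box neg) (dia neg) (fun B' D' =>
      forall a b, B' a ⊓ D' b ⊑ D' (a ⊔ b))
  | fwd (box pos), pos => when2 A (box pos) (dia pos) (fun B D =>
      forall a b, B (a ⊔ b) ⊑ B a ⊔ D b)
  | fwd (box neg), neg => when2 A (box neg) (dia neg) (fun B' D' =>
      forall a b, B' (a ⊓ b) ⊑ B' a ⊔ D' b)
  | fwd (dia pos), neg => when2 A (box neg) (dia pos) (fun B' D =>
      forall a, B' a ⊓ D a ⊑ bot)
  | fwd (dia neg), pos => when2 A (box pos) (dia neg) (fun B D' =>
      forall a, B a ⊓ D' a ⊑ bot)
  | fwd (box pos), neg => when2 A (box pos) (dia neg) (fun B D' =>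
      forall a, top ⊑ B a ⊔ D' a)
  | fwd (box neg), pos => when2 A (box neg) (dia pos) (fun B' D =>
      forall a, top ⊑ B' a ⊔ D a)
  | bwd (dia pos), pos => when2 A (box pos) (dia pos) (fun B D =>
      forall i a b, imp i (D a) (B b) ⊑ B (imp i a b))
  | bwd (dia neg), neg => when2 A (box neg) (dia neg) (fun B' D' =>
      forall i j a b, D' (imp i a b) ⊑ coimp j (D' b) (B' a))
  | bwd (box pos), pos => when2 A (box pos) (dia pos) (fun B D =>
      forall j a b, D (coimp j b a) ⊑ coimp j (D b) (B a))
  | bwd (box neg), neg => when2 A (box neg) (dia neg) (fun B' D' =>
      forall i j a b, imp i (D' a) (B' b) ⊑ B' (coimp j b a))
  | bwd (dia pos), neg => when2 A (box neg) (box pos) (fun B' B =>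
      forall i a, B' a ⊑ B (imp i a bot))
  | bwd (dia neg), pos => when2 A (dia neg) (dia pos) (fun D' D =>
      forall i a, D' (imp i a bot) ⊑ D a)
  | bwd (box pos), neg => when2 A (dia pos) (dia neg) (fun D D' =>
      forall j a, D (coimp j top a) ⊑ D' a)
  | bwd (box neg), pos => when2 A (box pos) (box neg) (fun B B' =>
      forall j a, B a ⊑ B' (coimp j top a))
  end.

(** The connectives occurring in [locality_eq _ m s]. *)
Definition uses_imp (m : modality) (s : sign) : bool :=
  match m, s with
  | bwd (dia _), _ | bwd (box neg), neg => true
  | _, _ => false
  end.

Definition uses_coimp (m : modality) (s : sign) : bool :=
  match m, s with
  | bwd (box _), _ | bwd (dia neg), neg => true
  | _, _ => false
  end.

Definition in_force (L : fmod -> bool) (L' : modality -> bool)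
    (m : modality) (s : sign) : bool :=
  L' m && L (base m) && L (base (opposite m s)).

Definition all_fmods : list fmod := [box pos; box neg; dia pos; dia neg].
Definition all_modalities : list modality :=
  map fwd all_fmods ++ map bwd all_fmods.

Definition requires (uses : modality -> sign -> bool)
    (L : fmod -> bool) (L' : modality -> bool) : bool :=
  existsb (fun m => existsb (fun s => in_force L L' m s && uses m s) [pos; neg])
    all_modalities.

Lemma requiresP uses L L' :
  requires uses L L' <-> exists m s, in_force L L' m s /\ uses m s.
Proof.
  unfold requires, is_true. rewrite existsb_exists. split.
  - intros (m & _ & H). apply existsb_exists in H. destruct H as (s & _ & H).
    apply andb_prop in H. now exists m, s.
  - intros (m & s & H1 & H2). exists m. split.
    + destruct m as [[[]|[]]|[[]|[]]]; cbn; tauto.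
    + apply existsb_exists. exists s. split.
      * destruct s; cbn; tauto.
      * now rewrite H1, H2.
Qed.

(** The residuated connectives belong to the signature exactly if they occur in
    some locality equation which is in force; by [requiresP], the
    quantification over [i] and [j] in [locality_eq] is then never vacuous for
    such an equation. *)
Definition local_signature (L : fmod -> bool) (L' : modality -> bool) :=
  Signature L (requires uses_imp L L') (requires uses_coimp L L').

Definition residuated {S} (A : algebra S) : Prop :=
  (forall i (a b c : A), c ⊑ imp i a b <-> a ⊓ c ⊑ b) /\
  (forall j (a b c : A), coimp j b a ⊑ c <-> b ⊑ a ⊔ c).

Definition local_unimodal_algebra (L : fmod -> bool) (L' : modality -> bool)
    (A : algebra (local_signature L L')) : Prop :=
  unimodal_algebra A /\ residuated A /\
  forall m, L' m -> forall s, locality_eq A m s.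

(** * Frames *)

(** Diagrammatic order: first [R1], then [R2]. *)
Definition rcomp {W} (R1 R2 : relation W) : relation W :=
  fun u w => exists v, R1 u v /\ R2 v w.

Notation "R1 ∘ R2" := (rcomp R1 R2) (at level 40, left associativity).

Definition generated_rel {W} (le R : relation W) (m : fmod) : relation W :=
  let ge := transp W le in
  match m with
  | box pos => le ∘ R ∘ le
  | dia pos => ge ∘ R ∘ ge
  | box neg => le ∘ R ∘ ge
  | dia neg => ge ∘ R ∘ le
  end.

(** The set of worlds may be empty, which accounts for the trivial algebra. *)
Record unimodal_frame (L : fmod -> bool) := UnimodalFrame {
  world :> Type;
  fle : relation world;
  frel : relation world;
  fle_order : order world fle;
  frel_inter : forall u v,
    frel u v <-> forall m, L m -> generated_rel fle frel m u v
}.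
Arguments fle {L} {_}.
Arguments frel {L} {_}.
Arguments fle_order {L} _.

Definition frame_locality {L} (F : unimodal_frame L) (m : modality) : Prop :=
  let le := @fle L F in
  let ge := transp F le in
  let R := @frel L F in
  match m with
  | fwd (dia pos) => inclusion F (ge ∘ R) (R ∘ ge)
  | fwd (dia neg) => inclusion F (ge ∘ R) (R ∘ le)
  | fwd (box pos) => inclusion F (le ∘ R) (R ∘ le)
  | fwd (box neg) => inclusion F (le ∘ R) (R ∘ ge)
  | bwd (dia pos) => inclusion F (R ∘ le) (le ∘ R)
  | bwd (dia neg) => inclusion F (R ∘ le) (ge ∘ R)
  | bwd (box pos) => inclusion F (R ∘ ge) (ge ∘ R)
  | bwd (box neg) => inclusion F (R ∘ ge) (le ∘ R)
  end.

Definition local_frame (L : fmod -> bool) (L' : modality -> bool)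
    (F : unimodal_frame L) : Prop :=
  forall m, L' m -> frame_locality F m.

(** * Complex algebras *)

Section ComplexAlgebra.
Variables (S : signature) (F : unimodal_frame (modals S)).
Implicit Types (u v w : F).

Definition is_upset (a : F -> Prop) : Prop := forall u v, fle u v -> a u -> a v.

Definition upset := {a : F -> Prop | is_upset a}.

Definition mem (u : F) (a : upset) : Prop := proj1_sig a u.

Let grel := generated_rel (@fle _ F) (@frel _ F).

Lemma cbot_upset : is_upset (fun _ => False).
Proof. now intros u v _. Qed.

Lemma ctop_upset : is_upset (fun _ => True).
Proof. now intros u v _. Qed.

Lemma cmeet_upset (a b : upset) : is_upset (fun u => mem u a /\ mem u b).
Proof.
  destruct a as [a Ha], b as [b Hb]. unfold mem; cbn. intros u v uv [H1 H2].
  split; [now apply (Ha u)|now apply (Hb u)].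
Qed.

Lemma cjoin_upset (a b : upset) : is_upset (fun u => mem u a \/ mem u b).
Proof.
  destruct a as [a Ha], b as [b Hb]. unfold mem; cbn. intros u v uv [H|H].
  - left; now apply (Ha u).
  - right; now apply (Hb u).
Qed.

Lemma cimp_upset (a b : upset) :
  is_upset (fun u => forall w, fle u w -> mem w a -> mem w b).
Proof.
  intros u v uv H w vw. apply H. now apply (ord_trans F _ (fle_order F) u v w).
Qed.

Lemma ccoimp_upset (b a : upset) :
  is_upset (fun u => exists w, fle w u /\ mem w b /\ ~ mem w a).
Proof.
  intros u v uv (w & wu & H). exists w. split; [|exact H].
  now apply (ord_trans F _ (fle_order F) w u v).
Qed.

Definition cmodal_pred (m : fmod) (a : upset) : F -> Prop :=
  match m with
  | box pos => fun u => forall v, grel (box pos) u v -> mem v a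
  | box neg => fun u => forall v, grel (box neg) u v -> ~ mem v a
  | dia pos => fun u => exists v, mem v a /\ grel (dia pos) u v
  | dia neg => fun u => exists v, ~ mem v a /\ grel (dia neg) u v
  end.

Lemma cmodal_upset (m : fmod) (a : upset) : is_upset (cmodal_pred m a).
Proof.
  pose proof (ord_trans F _ (fle_order F)) as T.
  assert (Hbox : forall (R : relation F) (P : F -> Prop),
    is_upset (fun u => forall v, (fle ∘ frel ∘ R) u v -> P v)).
  { intros R P u v uv H w (x & (y & vy & yx) & xw). apply H.
    exists x. split; [|exact xw]. exists y. split; [|exact yx].
    exact (T _ _ _ uv vy). }
  assert (Hdia : forall (R : relation F) (P : F -> Prop),
    is_upset (fun u => exists v, P v /\ (transp F fle ∘ frel ∘ R) u v)).
  { intros R P u v uv (w & Pw & x & (y & uy & yx) & xw).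
    exists w. split; [exact Pw|]. exists x. split; [|exact xw].
    exists y. split; [|exact yx]. exact (T _ _ _ uy uv). }
  destruct m as [[]|[]].
  - apply Hbox.
  - apply (Hbox _ (fun v => ~ mem v a)).
  - apply (Hdia _ (fun v => mem v a)).
  - apply (Hdia _ (fun v => ~ mem v a)).
Qed.

Definition complex_algebra : algebra S := {|
  carrier := upset;
  bot := exist _ _ cbot_upset;
  top := exist _ _ ctop_upset;
  meet := fun a b => exist _ _ (cmeet_upset a b);
  join := fun a b => exist _ _ (cjoin_upset a b);
  imp := fun _ a b => exist _ _ (cimp_upset a b);
  coimp := fun _ b a => exist _ _ (ccoimp_upset b a);
  modal := fun m _ a => exist _ _ (cmodal_upset m a)
|}.

End ComplexAlgebra.

Definition local_complex_algebra (L : fmod -> bool) (L' : modality -> bool)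
    (A : algebra (local_signature L L')) : Prop :=
  exists F : unimodal_frame L,
    local_frame L' F /\ A = complex_algebra (local_signature L L') F.

(** * Universal classes *)

Inductive term (S : signature) :=
| TVar (n : nat)
| TBot
| TTop
| TMeet (s t : term S)
| TJoin (s t : term S)
| TImp (i : has_imp S) (s t : term S)
| TCoimp (j : has_coimp S) (s t : term S)
| TModal (m : fmod) (h : modals S m) (t : term S).
Arguments TVar {S} n.
Arguments TBot {S}.
Arguments TTop {S}.
Arguments TModal {S} m h t.

Fixpoint eval {S} (A : algebra S) (v : nat -> A) (t : term S) : A :=
  match t with
  | TVar n => v n
  | TBot => bot
  | TTop => top
  | TMeet s t => eval A v s ⊓ eval A v t
  | TJoin s t => eval A v s ⊔ eval A v t
  | TImp i s t => imp i (eval A v s) (eval A v t)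
  | TCoimp j s t => coimp j (eval A v s) (eval A v t)
  | TModal m h t => modal A m h (eval A v t)
  end.

Inductive qf_formula (S : signature) :=
| QEq (s t : term S)
| QFalse
| QAnd (p q : qf_formula S)
| QOr (p q : qf_formula S)
| QImp (p q : qf_formula S).
Arguments QFalse {S}.

Fixpoint holds {S} (A : algebra S) (v : nat -> A) (p : qf_formula S) : Prop :=
  match p with
  | QEq s t => eval A v s = eval A v t
  | QFalse => False
  | QAnd p q => holds A v p /\ holds A v q
  | QOr p q => holds A v p \/ holds A v q
  | QImp p q => holds A v p -> holds A v q
  end.

(** Validity of the universal closure of [p]. *)
Definition valid {S} (A : algebra S) (p : qf_formula S) : Prop :=
  forall v : nat -> A, holds A v p.

Definition universal_class {S} (K : algebra S -> Prop) : Prop :=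
  exists T : qf_formula S -> Prop,
    forall A, K A <-> forall p, T p -> valid A p.

(** [K] is the least universal class containing [G]. *)
Definition generated_as_universal_class {S} (K G : algebra S -> Prop) : Prop :=
  universal_class K /\
  (forall A, G A -> K A) /\
  forall K', universal_class K' ->
    (forall A, G A -> K' A) -> forall A, K A -> K' A.

(* Main.v *)
(** Each forward modality preserves finite meets after dualizing its domain or
    its codomain, so that signs [r] (inner) and [s] (outer) turn the axioms and
    frame conditions into a few schemes indexed by [(s, r)]. An algebra embeds
    into the complex algebra of its frame of prime filters, whose relation is
    the intersection of the canonical relations of the modalities. To see that
    this relation generates the canonical relation of a modality from [u] to
    [v], pass by Zorn's lemma to a pair [(u', v')] in that relation with [u']
    maximal above [u] and [v'] minimal below [v] (in the signed orders); the
    quasiequations say that such a pair lies in all the other canonical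
    relations. The locality conditions of the frame follow from the locality
    equations by prime filter separation. *)

From Stdlib Require Import Relations.
From Stdlib Require Import Classical ClassicalEpsilon.
From Stdlib Require Import FunctionalExtensionality PropExtensionality ProofIrrelevance.
From mathcomp Require boolp classical_sets.
Require Import Defs.

Set Implicit Arguments.
Set Bullet Behavior "Strict Subproofs".

(** * Signed operations *)

Definition opp (s : sign) : sign := match s with pos => neg | neg => pos end.

(* [op s r] preserves finite meets from the [r]-signed to the [s]-signed
   lattice, where sign [neg] means the order dual. *)
Definition op (s r : sign) : fmod :=
  match s, r with
  | pos, pos => box pos
  | pos, neg => box neg
  | neg, pos => dia neg
  | neg, neg => dia pos
  end.

Definition smeet {S} {A : algebra S} (s : sign) (a b : A) : A :=
  match s with pos => a ⊓ b | neg => a ⊔ b end.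

Definition stop {S} {A : algebra S} (s : sign) : A :=
  match s with pos => top | neg => bot end.

Definition sle {S} {A : algebra S} (s : sign) (a b : A) : Prop :=
  match s with pos => a ⊑ b | neg => b ⊑ a end.

Notation sjoin s := (smeet (opp s)).
Notation sbot s := (stop (opp s)).

Definition has_simp (S : signature) (s : sign) : bool :=
  match s with pos => has_imp S | neg => has_coimp S end.

(** In the order dual, the residual of [smeet] by [a] is co-implication with its arguments
    exchanged. *)
Definition simp {S} {A : algebra S} (s : sign) :
    has_simp S s -> A -> A -> A :=
  match s with
  | pos => fun i a b => imp i a b
  | neg => fun j a b => coimp j b a
  end.

Definition srel {W} (s : sign) (le : relation W) : relation W :=
  match s with pos => le | neg => transp W le end.

(** Each scheme has four instances, one for each [(s, r)]. [sa_uni1], [sa_uni2] and [sa_uni3] gather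
    quasiequations 1 to 4, 5 to 8 and 9 to 12, and the sixteen locality equations become the last
    four schemes. As [adjoint] is an involution, [bwd (adjoint (op s r))] is the backward modality
    with base [op s r]. *)
Record signed_axioms {S} (L' : modality -> bool) (A : algebra S) : Prop := {
  sa_lattice : bounded_distributive_lattice A;
  sa_meet : forall s r (h : modals S (op s r)) a b,
    modal A _ h (smeet r a b) = smeet s (modal A _ h a) (modal A _ h b);
  sa_top : forall s r (h : modals S (op s r)),
    modal A _ h (stop r) = stop s;
  sa_uni1 : forall s r (h : modals S (op s r)) (k : modals S (op s (opp r))) a b,
    sle s (smeet s (modal A _ k a) (modal A _ h (sjoin r a b))) (modal A _ h b);
  sa_uni2 : forall s r (h : modals S (op s r)) (k : modals S (op (opp s) r)) a c,
    sle s (smeet s (modal A _ k a) c) (modal A _ h a) ->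
    sle s c (modal A _ h a);
  sa_uni3 : forall s r (h : modals S (op s r))
      (k : modals S (op (opp s) (opp r))) a b c,
    sle s (smeet s (modal A _ k b) c) (modal A _ h a) ->
    sle s (smeet s (modal A _ h (sjoin r a b)) c) (modal A _ h a);
  sa_residuated : forall s (i : has_simp S s) (a b c : A),
    sle s c (simp s i a b) <-> sle s (smeet s a c) b;
  sa_fwd_opp : forall s r, L' (fwd (op s r)) ->
    forall (h : modals S (op s r)) (k : modals S (op (opp s) (opp r))) a b,
    sle s (modal A _ h (sjoin r a b)) (sjoin s (modal A _ h a) (modal A _ k b));
  sa_fwd_same : forall s r, L' (fwd (op s r)) ->
    forall (h : modals S (op s r)) (k : modals S (op (opp s) r)) a,
    sle s (stop s) (sjoin s (modal A _ h a) (modal A _ k a));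
  sa_bwd_opp : forall s r, L' (bwd (adjoint (op s r))) ->
    forall (h : modals S (op s r)) (k : modals S (op (opp s) (opp r)))
      (i : has_simp S s) (j : has_simp S r) a b,
    sle s (simp s i (modal A _ k a) (modal A _ h b)) (modal A _ h (simp r j a b));
  sa_bwd_same : forall s r, L' (bwd (adjoint (op s r))) ->
    forall (h : modals S (op s r)) (k : modals S (op s (opp r)))
      (j : has_simp S r) a,
    sle s (modal A _ k a) (modal A _ h (simp r j a (sbot r)))
}.

Lemma signed_axiomsP L L' (A : algebra (local_signature L L')) :
  local_unimodal_algebra A <-> signed_axioms L' A.
Proof.
  split.
  - intros ([[lat bp dp bn dn] u1 u2 u3 u4 u5 u6 u7 u8 u9 u10 u11 u12]
      & [ri rc] & loc).
    split.
    + exact lat.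
    + intros [] [] h; [apply bp|apply bn|apply dn|apply dp].
    + intros [] [] h; [apply bp|apply bn|apply dn|apply dp].
    + intros [] [] h k a b; cbn; [apply u1|apply u2| |];
        rewrite (joinC lat); [apply u4|apply u3].
    + intros [] [] h k a c; [apply u5|apply u6|apply u8|apply u7].
    + intros [] [] h k a b c; [apply u9|apply u10|apply u12|apply u11].
    + intros [] i a b c; [apply ri|apply rc].
    + intros [] [] Hm h k a b; cbn in h, k |- *.
      * apply (loc _ Hm pos).
      * apply (loc _ Hm neg).
      * rewrite (meetC lat), (joinC lat). apply (loc _ Hm neg).
      * rewrite (meetC lat (modal A _ h a)), (meetC lat a b). apply (loc _ Hm pos).
    + intros [] [] Hm h k a; cbn in h, k |- *.
      * apply (loc _ Hm neg).
      * apply (loc _ Hm pos).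
      * rewrite (meetC lat). apply (loc _ Hm pos).
      * rewrite (meetC lat). apply (loc _ Hm neg).
    + intros [] [] Hm h k i j a b; cbn in h, k, i, j |- *.
      (* For [s = r] both residuals are the same connective, and the unsigned equation carries a
         single witness of its presence. *)
      * rewrite (proof_irrelevance _ i j). apply (loc _ Hm pos).
      * apply (loc _ Hm neg).
      * apply (loc _ Hm neg).
      * rewrite (proof_irrelevance _ i j). apply (loc _ Hm pos).
    + intros [] [] Hm h k j a; cbn in h, k, j |- *.
      * apply (loc _ Hm neg).
      * apply (loc _ Hm pos).
      * apply (loc _ Hm pos).
      * apply (loc _ Hm neg).
  - intros [lat mt tp u1 u2 u3 res fo fs bo bs].
    split; [split; [split|..]|split; [split|]].
    + exact lat.
    + intros h; split; [apply (mt pos pos)|apply (tp pos pos)].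
    + intros h; split; [apply (mt neg neg)|apply (tp neg neg)].
    + intros h; split; [apply (mt pos neg)|apply (tp pos neg)].
    + intros h; split; [apply (mt neg pos)|apply (tp neg pos)].
    + intros h k; apply (u1 pos pos).
    + intros h k; apply (u1 pos neg).
    + intros h k a b; rewrite (joinC lat); apply (u1 neg neg).
    + intros h k a b; rewrite (joinC lat); apply (u1 neg pos).
    + intros h k; apply (u2 pos pos).
    + intros h k; apply (u2 pos neg).
    + intros h k; apply (u2 neg neg).
    + intros h k; apply (u2 neg pos).
    + intros h k; apply (u3 pos pos).
    + intros h k; apply (u3 pos neg).
    + intros h k; apply (u3 neg neg).
    + intros h k; apply (u3 neg pos).
    + apply (res pos).
    + apply (res neg).
    + intros [[[]|[]]|[[]|[]]] Hm [] h k.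
      * apply (fo pos pos Hm).
      * apply (fs pos pos Hm).
      * apply (fs pos neg Hm).
      * apply (fo pos neg Hm).
      * intros a b. rewrite (meetC lat (modal A _ h a)), (meetC lat a b).
        apply (fo neg neg Hm).
      * intros a. rewrite (meetC lat). apply (fs neg neg Hm).
      * intros a. rewrite (meetC lat). apply (fs neg pos Hm).
      * intros a b. rewrite (meetC lat), (joinC lat). apply (fo neg pos Hm).
      * intros j. apply (bo neg neg Hm _ _ j j).
      * intros j. apply (bs neg neg Hm).
      * intros j. apply (bs pos neg Hm).
      * intros i j. apply (bo pos neg Hm _ _ i j).
      * intros i. apply (bo pos pos Hm _ _ i i).
      * intros i. apply (bs pos pos Hm).
      * intros i. apply (bs neg pos Hm).
      * intros i j. apply (bo neg pos Hm _ _ j i).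
Qed.

(** * The axioms as universal formulas *)

Section Formulas.
Variable S : signature.
Implicit Types (s r : sign) (x y : term S).

Definition tsmeet s x y := match s with pos => TMeet x y | neg => TJoin x y end.
Definition tstop s : term S := match s with pos => TTop | neg => TBot end.
Definition tsimp s : has_simp S s -> term S -> term S -> term S :=
  match s with
  | pos => fun i x y => TImp i x y
  | neg => fun j x y => TCoimp j y x
  end.
Definition qsle s x y : qf_formula S :=
  match s with
  | pos => QEq (TMeet x y) x
  | neg => QEq (TMeet y x) y
  end.

Lemma eval_tsmeet (A : algebra S) v s x y :
  eval A v (tsmeet s x y) = smeet s (eval A v x) (eval A v y).
Proof. now destruct s. Qed.

Lemma eval_tstop (A : algebra S) v s : eval A v (tstop s) = stop s.
Proof. now destruct s. Qed.

Lemma eval_tsimp (A : algebra S) v s i x y :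
  eval A v (tsimp s i x y) = simp s i (eval A v x) (eval A v y).
Proof. now destruct s. Qed.

Lemma holds_qsle (A : algebra S) v s x y :
  holds A v (qsle s x y) = sle s (eval A v x) (eval A v y).
Proof. now destruct s. Qed.

End Formulas.

Ltac eval_signed :=
  cbn [holds];
  rewrite ?holds_qsle; cbn [eval];
  rewrite ?eval_tsmeet, ?eval_tstop, ?eval_tsimp; cbn [eval];
  rewrite ?eval_tsmeet, ?eval_tstop, ?eval_tsimp; cbn [eval].

(** The axiom [ax] is written as a formula [p]; [p] is valid in all models of the signed axioms,
    hence in [A] by [T], and the instance at [v] is the wanted one. *)
Ltac transfer T v p ax :=
  let H := fresh in
  assert (H : holds _ v p);
  [ apply T; let B := fresh in let HB := fresh in let w := fresh in
    intros B HB w; eval_signed; apply (ax _ _ B HB); assumption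
  | revert H; eval_signed; intros H; exact H ].

(** Take as theory all formulas valid throughout the class. Each signed axiom is such a formula: the
    presence of symbols and membership in [L'] depend on the signature and on [L'] only, so these
    conditions stay outside the formula. *)
Lemma local_unimodal_universal L L' :
  universal_class (@local_unimodal_algebra L L').
Proof.
  exists (fun p => forall A, local_unimodal_algebra A -> valid A p).
  intros A. split; [intros HA p Hp; exact (Hp A HA)|]. intros H.
  assert (T : forall p, (forall B, signed_axioms L' B -> valid B p) -> valid A p).
  { intros p Hp. apply H. intros B HB. apply Hp. now apply signed_axiomsP. }
  clear H. apply signed_axiomsP.
  set (S := local_signature L L') in *.
  pose (val := fun (a b c : A) n => match n with 0 => a | 1 => b | _ => c end).
  pose (x := @TVar S 0). pose (y := @TVar S 1). pose (z := @TVar S 2).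
  split.
  - split.
    + exact (fun a b c => T (QEq (TMeet x (TMeet y z)) (TMeet (TMeet x y) z))
        (fun B HB v => meetA (sa_lattice HB) _ _ _) (val a b c)).
    + exact (fun a b => T (QEq (TMeet x y) (TMeet y x))
        (fun B HB v => meetC (sa_lattice HB) _ _) (val a b a)).
    + exact (fun a b c => T (QEq (TJoin x (TJoin y z)) (TJoin (TJoin x y) z))
        (fun B HB v => joinA (sa_lattice HB) _ _ _) (val a b c)).
    + exact (fun a b => T (QEq (TJoin x y) (TJoin y x))
        (fun B HB v => joinC (sa_lattice HB) _ _) (val a b a)).
    + exact (fun a b => T (QEq (TMeet x (TJoin x y)) x)
        (fun B HB v => meet_join_absorb (sa_lattice HB) _ _) (val a b a)).
    + exact (fun a b => T (QEq (TJoin x (TMeet x y)) x)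
        (fun B HB v => join_meet_absorb (sa_lattice HB) _ _) (val a b a)).
    + exact (fun a b c => T
        (QEq (TMeet x (TJoin y z)) (TJoin (TMeet x y) (TMeet x z)))
        (fun B HB v => meet_join_distr (sa_lattice HB) _ _ _) (val a b c)).
    + exact (fun a => T (QEq (TJoin x TBot) x)
        (fun B HB v => join_bot (sa_lattice HB) _) (val a a a)).
    + exact (fun a => T (QEq (TMeet x TTop) x)
        (fun B HB v => meet_top (sa_lattice HB) _) (val a a a)).
  - intros s r h a b. transfer T (val a b a)
      (QEq (TModal _ h (tsmeet r x y)) (tsmeet s (TModal _ h x) (TModal _ h y)))
      (@sa_meet).
  (* The formula is closed, so any valuation serves. *)
  - intros s r h. transfer T (fun _ : nat => @top S A)
      (QEq (TModal _ h (tstop S r)) (tstop S s)) (@sa_top).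
  - intros s r h k a b. transfer T (val a b a)
      (qsle s (tsmeet s (TModal _ k x) (TModal _ h (tsmeet (opp r) x y)))
         (TModal _ h y)) (@sa_uni1).
  - intros s r h k a c. transfer T (val a a c)
      (QImp (qsle s (tsmeet s (TModal _ k x) z) (TModal _ h x))
         (qsle s z (TModal _ h x))) (@sa_uni2).
  - intros s r h k a b c. transfer T (val a b c)
      (QImp (qsle s (tsmeet s (TModal _ k y) z) (TModal _ h x))
         (qsle s (tsmeet s (TModal _ h (tsmeet (opp r) x y)) z) (TModal _ h x)))
      (@sa_uni3).
  - intros s i a b c. transfer T (val a b c)
      (QAnd (QImp (qsle s z (tsimp s i x y)) (qsle s (tsmeet s x z) y))
         (QImp (qsle s (tsmeet s x z) y) (qsle s z (tsimp s i x y))))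
      (@sa_residuated).
  - intros s r Hm h k a b. transfer T (val a b a)
      (qsle s (TModal _ h (tsmeet (opp r) x y))
         (tsmeet (opp s) (TModal _ h x) (TModal _ k y))) (@sa_fwd_opp).
  - intros s r Hm h k a. transfer T (val a a a)
      (qsle s (tstop S s) (tsmeet (opp s) (TModal _ h x) (TModal _ k x)))
      (@sa_fwd_same).
  - intros s r Hm h k i j a b. transfer T (val a b a)
      (qsle s (tsimp s i (TModal _ k x) (TModal _ h y))
         (TModal _ h (tsimp r j x y))) (@sa_bwd_opp).
  - intros s r Hm h k j a. transfer T (val a a a)
      (qsle s (TModal _ k x) (TModal _ h (tsimp r j x (tstop S (opp r)))))
      (@sa_bwd_same).
Qed.

(** * Prime filters *)

(** The underlying form of Zorn's lemma takes Boolean relations, whence [asbool]. The point [t0]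
    bounds the empty chain, so that only nonempty chains are left to bound. *)
Lemma zorn_preorder T (t0 : T) (R : relation T) :
  reflexive T R -> transitive T R ->
  (forall C : T -> Prop, (exists x, C x) ->
    (forall x y, C x -> C y -> R x y \/ R y x) ->
    exists z, forall x, C x -> R x z) ->
  exists x, forall y, R x y -> R y x.
Proof.
  intros Rr Rt ub.
  pose (Rb x y := boolp.asbool (R x y)).
  assert (E : forall x y, is_true (Rb x y) <-> R x y).
  { intros x y. unfold Rb. rewrite boolp.asboolE. reflexivity. }
  destruct (@classical_sets.ZL_preorder T t0 Rb) as [x Hx].
  - intros x. now apply E.
  - intros x y z. rewrite !E. apply Rt.
  - intros C HC. destruct (classic (exists x, C x)) as [ne|ne].
    + destruct (ub C ne) as [z Hz].
      * intros x y Cx Cy. rewrite <- !E. now apply HC.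
      * exists z. intros x Cx. now apply E, Hz.
    + exists t0. intros x Cx. destruct ne. now exists x.
  - exists x. intros y. specialize (Hx y). cbn in Hx. rewrite !E in Hx. exact Hx.
Qed.

(** * Order theory of the signed lattice *)

Lemma oppK s : opp (opp s) = s.
Proof. now destruct s. Qed.

Lemma sle_opp {S} {A : algebra S} s (a b : A) : sle (opp s) a b <-> sle s b a.
Proof. now destruct s. Qed.

Section Lattice.
Variables (S : signature) (A : algebra S).
Hypothesis lat : bounded_distributive_lattice A.
Implicit Types (s : sign) (a b c : A).

Lemma leq_join a b : a ⊑ b <-> a ⊔ b = b.
Proof.
  split; intros H.
  - rewrite <- H, (joinC lat), (meetC lat). apply (join_meet_absorb lat).
  - red. rewrite <- H. apply (meet_join_absorb lat).
Qed.

Lemma meet_idem a : a ⊓ a = a.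
Proof.
  rewrite <- (join_meet_absorb lat a a) at 2. apply (meet_join_absorb lat).
Qed.

Lemma join_idem a : a ⊔ a = a.
Proof. apply leq_join, meet_idem. Qed.

Lemma sle_meet s a b : sle s a b <-> smeet s a b = a.
Proof. destruct s; [reflexivity|]. cbn. rewrite leq_join, (joinC lat). reflexivity. Qed.

Lemma smeetA s a b c : smeet s a (smeet s b c) = smeet s (smeet s a b) c.
Proof. destruct s; [apply (meetA lat)|apply (joinA lat)]. Qed.

Lemma smeetC s a b : smeet s a b = smeet s b a.
Proof. destruct s; [apply (meetC lat)|apply (joinC lat)]. Qed.

Lemma smeet_idem s a : smeet s a a = a.
Proof. destruct s; [apply meet_idem|apply join_idem]. Qed.

Lemma sle_refl s a : sle s a a.
Proof. apply sle_meet, smeet_idem. Qed.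

Lemma sle_trans s a b c : sle s a b -> sle s b c -> sle s a c.
Proof.
  rewrite !sle_meet. intros H1 H2. now rewrite <- H1, <- smeetA, H2.
Qed.

Lemma sle_antisym s a b : sle s a b -> sle s b a -> a = b.
Proof. rewrite !sle_meet, (smeetC s b a). congruence. Qed.

Lemma smeet_l s a b : sle s (smeet s a b) a.
Proof. apply sle_meet. now rewrite smeetC, smeetA, smeet_idem. Qed.

Lemma smeet_r s a b : sle s (smeet s a b) b.
Proof. rewrite smeetC. apply smeet_l. Qed.

Lemma smeet_glb s a b c : sle s c a -> sle s c b -> sle s c (smeet s a b).
Proof. rewrite !sle_meet. intros H1 H2. now rewrite smeetA, H1. Qed.

Lemma sjoin_l s a b : sle s a (sjoin s a b).
Proof. apply sle_opp, smeet_l. Qed.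

Lemma sjoin_r s a b : sle s b (sjoin s a b).
Proof. apply sle_opp, smeet_r. Qed.

Lemma sjoin_lub s a b c : sle s a c -> sle s b c -> sle s (sjoin s a b) c.
Proof. rewrite <- !(sle_opp s). apply smeet_glb. Qed.

Lemma sle_stop s a : sle s a (stop s).
Proof.
  apply sle_meet. destruct s; [apply (meet_top lat)|apply (join_bot lat)].
Qed.

Lemma sbot_sle s a : sle s (sbot s) a.
Proof. apply sle_opp, sle_stop. Qed.

Lemma sdistr s a b c :
  smeet s a (sjoin s b c) = sjoin s (smeet s a b) (smeet s a c).
Proof.
  destruct s; cbn; [apply (meet_join_distr lat)|].
  (* The dual law: expanding [(a ⊔ b) ⊓ (a ⊔ c)] gives [a ⊔ (c ⊓ a) ⊔ (c ⊓ b)], where absorption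
     removes the middle term. *)
  rewrite (meet_join_distr lat), (meetC lat _ a), (meet_join_absorb lat).
  rewrite (meetC lat (a ⊔ b) c), (meet_join_distr lat), (joinA lat).
  rewrite (meetC lat c a), (join_meet_absorb lat). now rewrite (meetC lat c b).
Qed.

End Lattice.

(** * Points and prime filter separation *)

Definition prime {S} {A : algebra S} (P : A -> Prop) : Prop :=
  P top /\ ~ P bot /\
  (forall a b, P (a ⊓ b) <-> P a /\ P b) /\
  (forall a b, P (a ⊔ b) <-> P a \/ P b).

Record point {S} (A : algebra S) := Point {
  pmem :> A -> Prop;
  pprime : prime pmem
}.

(** For sign [neg] this is membership in the complementary prime ideal, which is a prime filter of
    the order dual. One point thus serves both signs. *)
Definition smem {S} {A : algebra S} (s : sign) (u : point A) (a : A) : Prop :=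
  match s with pos => u a | neg => ~ u a end.

Definition ple {S} {A : algebra S} (s : sign) (u v : point A) : Prop :=
  forall a, smem s u a -> smem s v a.

Section Points.
Variables (S : signature) (A : algebra S).
Implicit Types (s : sign) (a b c : A) (u v : point A).

Lemma smem_opp s u a : smem (opp s) u a <-> ~ smem s u a.
Proof. destruct s; cbn; [tauto|split; [tauto|apply NNPP]]. Qed.

Lemma smem_meet s u a b : smem s u (smeet s a b) <-> smem s u a /\ smem s u b.
Proof.
  destruct (pprime u) as (_ & _ & Hm & Hj).
  destruct s; cbn; [apply Hm|rewrite Hj; tauto].
Qed.

Lemma smem_join s u a b : smem s u (sjoin s a b) <-> smem s u a \/ smem s u b.
Proof.
  destruct (pprime u) as (_ & _ & Hm & Hj).
  destruct s; cbn; [apply Hj|rewrite Hm].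
  split; [apply not_and_or|tauto].
Qed.

Lemma smem_top s u : smem s u (stop s).
Proof. destruct (pprime u) as (Ht & Hb & _), s; cbn; tauto. Qed.

Lemma smem_bot s u : ~ smem s u (sbot s).
Proof. destruct (pprime u) as (Ht & Hb & _), s; cbn; tauto. Qed.

Lemma ple_refl s u : ple s u u.
Proof. now intros a. Qed.

Lemma ple_trans s u v w : ple s u v -> ple s v w -> ple s u w.
Proof. intros H1 H2 a H. now apply H2, H1. Qed.

Lemma ple_opp s u v : ple (opp s) u v <-> ple s v u.
Proof.
  unfold ple. split; intros H a; specialize (H a); rewrite !smem_opp in *.
  - intros Hv. apply NNPP. tauto.
  - tauto.
Qed.

Lemma point_ext u v : (forall a, u a <-> v a) -> u = v.
Proof.
  destruct u as [u Hu], v as [v Hv]; cbn. intros H.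
  assert (u = v) as <-.
  { apply functional_extensionality. intros a.
    now apply propositional_extensionality. }
  now rewrite (proof_irrelevance _ Hu Hv).
Qed.

Lemma signed_prime_exists s (Q : A -> Prop) :
  Q (stop s) -> ~ Q (sbot s) ->
  (forall a b, Q (smeet s a b) <-> Q a /\ Q b) ->
  (forall a b, Q (sjoin s a b) <-> Q a \/ Q b) ->
  exists u : point A, forall a, smem s u a <-> Q a.
Proof.
  intros Ht Hb Hm Hj. destruct s; cbn in *.
  - now exists (@Point S A Q (conj Ht (conj Hb (conj Hm Hj)))).
  - assert (HP : prime (fun a => ~ Q a)).
    { split; [exact Hb|]. split; [tauto|]. split; intros a b.
      - rewrite Hj. tauto.
      - rewrite Hm. split; [apply not_and_or|tauto]. }
    exists (Point HP). intros a. cbn. split; [apply NNPP|tauto].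
Qed.

(** The limit is the union of the signed filters; only closure under [smeet] uses the chain. For
    sign [neg] it is a union of ideals, hence an intersection of filters. *)
Lemma chain_limit s (C : point A -> Prop) :
  (exists u, C u) -> (forall u v, C u -> C v -> ple s u v \/ ple s v u) ->
  exists w, forall a, smem s w a <-> exists u, C u /\ smem s u a.
Proof.
  intros [u0 Cu0] chain. apply signed_prime_exists.
  - exists u0. split; [exact Cu0|apply smem_top].
  - intros (u & _ & Hu). now apply smem_bot in Hu.
  - intros a b. split.
    + intros (u & Cu & Hu). apply smem_meet in Hu.
      split; exists u; tauto.
    + intros [(u & Cu & Hu) (v & Cv & Hv)].
      destruct (chain u v Cu Cv) as [H|H];
        [exists v|exists u]; rewrite smem_meet; auto.
  - intros a b. split.
    + intros (u & Cu & Hu). apply smem_join in Hu as [Hu|Hu];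
        [left|right]; exists u; tauto.
    + intros [(u & Cu & Hu)|(u & Cu & Hu)]; exists u; rewrite smem_join; auto.
Qed.

Hypothesis lat : bounded_distributive_lattice A.

Lemma smem_le s u a b : sle s a b -> smem s u a -> smem s u b.
Proof.
  intros H Hu. apply (sle_meet lat) in H. rewrite <- H in Hu.
  now apply smem_meet in Hu.
Qed.

(** A base of an [s]-signed filter; with [opp s], a base of an [s]-signed ideal. Working with bases
    lets separation be applied to parametrized families without closing them first. *)
Definition directed s (X : A -> Prop) : Prop :=
  (exists x, X x) /\
  forall x y, X x -> X y -> exists z, X z /\ sle s z x /\ sle s z y.

Lemma directed_singleton s a : directed s (eq a).
Proof.
  split; [now exists a|]. intros x y <- <-.
  exists a. split; [reflexivity|split; apply (sle_refl lat)].
Qed.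

(** A filter that is maximal among those containing [X] and avoiding [Y] is prime, by distributivity
    and the directedness of [Y]. *)
Lemma prime_separation s (X Y : A -> Prop) :
  directed s X -> directed (opp s) Y ->
  (forall x y, X x -> Y y -> ~ sle s x y) ->
  exists u : point A,
    (forall x, X x -> smem s u x) /\ (forall y, Y y -> ~ smem s u y).
Proof.
  intros [[x0 Xx0] Xd] [[y0 Yy0] Yd] dis.
  pose (filter (F : A -> Prop) :=
    (forall a b, sle s a b -> F a -> F b) /\
    (forall a b, F a -> F b -> F (smeet s a b)) /\
    (forall x, X x -> F x) /\ (forall y, Y y -> ~ F y)).
  pose (T := {F | filter F}).
  assert (gen : filter (fun a => exists x, X x /\ sle s x a)).
  { split; [|split; [|split]].
    - intros a b ab (x & Xx & xa). exists x. split; [exact Xx|].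
      now apply (sle_trans lat) with a.
    - intros a b (x & Xx & xa) (y & Xy & yb).
      destruct (Xd x y Xx Xy) as (z & Xz & zx & zy).
      exists z. split; [exact Xz|].
      apply (smeet_glb lat);
        [apply (sle_trans lat) with x|apply (sle_trans lat) with y]; assumption.
    - intros x Xx. exists x. split; [exact Xx|apply (sle_refl lat)].
    - intros y Yy (x & Xx & xy). exact (dis x y Xx Yy xy). }
  destruct (@zorn_preorder T (exist _ _ gen)
    (fun F G => forall a, proj1_sig F a -> proj1_sig G a)) as [[F HF] max].
  - now intros F a.
  - intros F G H FG GH a Fa. now apply GH, FG.
  - intros C [F0 CF0] chain.
    assert (HU : filter (fun a => exists F, C F /\ proj1_sig F a)).
    { split; [|split; [|split]].
      - intros a b ab (F & CF & Fa). exists F. split; [exact CF|].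
        now apply (proj1 (proj2_sig F) a).
      - intros a b (F & CF & Fa) (G & CG & Gb).
        destruct (chain F G CF CG) as [H|H].
        + exists G. split; [exact CG|]. apply (proj1 (proj2 (proj2_sig G))); auto.
        + exists F. split; [exact CF|]. apply (proj1 (proj2 (proj2_sig F))); auto.
      - intros x Xx. exists F0. split; [exact CF0|].
        now apply (proj1 (proj2 (proj2 (proj2_sig F0)))).
      - intros y Yy (F & _ & Fy). exact (proj2 (proj2 (proj2 (proj2_sig F))) y Yy Fy). }
    exists (exist _ _ HU). intros F CF a Fa. now exists F.
  - cbn in max. pose proof HF as (up & mt & XF & YF).
    (* By maximality, the filter generated by [F] and some [a] outside [F] cannot avoid [Y]. *)
    assert (ext : forall a, ~ F a -> exists c y, F c /\ Y y /\ sle s (smeet s c a) y).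
    { intros a Fa. apply NNPP. intros no. apply Fa.
      assert (HG : filter (fun b => exists c, F c /\ sle s (smeet s c a) b)).
      { split; [|split; [|split]].
        - intros b d bd (c & Fc & H). exists c. split; [exact Fc|].
          now apply (sle_trans lat) with b.
        - intros b b' (c & Fc & H) (c' & Fc' & H').
          exists (smeet s c c'). split; [now apply mt|].
          apply (smeet_glb lat).
          + apply (sle_trans lat) with (smeet s c a); [|exact H].
            apply (smeet_glb lat); [|apply (smeet_r lat)].
            apply (sle_trans lat) with (smeet s c c'); apply (smeet_l lat).
          + apply (sle_trans lat) with (smeet s c' a); [|exact H'].
            apply (smeet_glb lat); [|apply (smeet_r lat)].
            apply (sle_trans lat) with (smeet s c c');
              [apply (smeet_l lat)|apply (smeet_r lat)].
        - intros x Xx. exists x. split; [now apply XF|apply (smeet_l lat)].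
        - intros y Yy (c & Fc & H). apply no. now exists c, y. }
      apply (max (exist _ _ HG)).
      - intros b Fb. exists b. split; [exact Fb|apply (smeet_l lat)].
      - exists x0. split; [now apply XF|apply (smeet_r lat)]. }
    assert (HQ : exists u : point A, forall a, smem s u a <-> F a).
    { apply signed_prime_exists.
      - apply (up x0); [apply (sle_stop lat)|now apply XF].
      - intros Fb. apply (YF y0 Yy0). apply (up (sbot s)); [|exact Fb].
        apply (sbot_sle lat).
      - intros a b. split.
        + intros Fab. split; (eapply up; [|exact Fab]);
            [apply (smeet_l lat)|apply (smeet_r lat)].
        + intros [Fa Fb]. now apply mt.
      - intros a b. split.
        + intros Fab. apply NNPP. intros no. apply not_or_and in no as [na nb].
          destruct (ext a na) as (c & y & Fc & Yy & Hy).
          destruct (ext b nb) as (d & z & Fd & Yz & Hz).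
          destruct (Yd y z Yy Yz) as (w & Yw & yw & zw). rewrite sle_opp in yw, zw.
          (* If both [a] and [b] were outside [F], then [c], [d] from [F] would put [smeet c d] met
             with the join of [a] and [b] below the common bound [w] in [Y]. *)
          apply (YF w Yw). apply (up (smeet s (smeet s c d) (sjoin s a b)));
            [|auto].
          rewrite (sdistr lat). apply (sjoin_lub lat).
          * apply (sle_trans lat) with y; [|exact yw].
            eapply (sle_trans lat); [|exact Hy].
            apply (smeet_glb lat); [|apply (smeet_r lat)].
            apply (sle_trans lat) with (smeet s c d); apply (smeet_l lat).
          * apply (sle_trans lat) with z; [|exact zw].
            eapply (sle_trans lat); [|exact Hz].
            apply (smeet_glb lat); [|apply (smeet_r lat)].
            apply (sle_trans lat) with (smeet s c d);
              [apply (smeet_l lat)|apply (smeet_r lat)].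
        + intros [Fa|Fb]; (eapply up; [|eassumption]);
            [apply (sjoin_l lat)|apply (sjoin_r lat)]. }
    destruct HQ as [u Hu]. exists u. split.
    + intros x Xx. now apply Hu, XF.
    + intros y Yy Huy. apply Hu in Huy. now apply (YF y).
Qed.

Lemma sle_points s a b : (forall u, smem s u a -> smem s u b) -> sle s a b.
Proof.
  intros H. apply NNPP. intros ab.
  destruct (@prime_separation s (eq a) (eq b)) as (u & Ha & Hb).
  - apply directed_singleton.
  - apply directed_singleton.
  - now intros x y <- <-.
  - apply (Hb b eq_refl), H, Ha. reflexivity.
Qed.

End Points.

Arguments directed {S A} s X.
Arguments smem_le {S A} lat [s] u [a b].

(** * Complex algebras *)

Lemma generated_relE {W} (le R : relation W) s r :
  generated_rel le R (op s r) = srel s le ∘ R ∘ srel r le.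
Proof. now destruct s, r. Qed.

Lemma frame_locality_fwd L (F : unimodal_frame L) s r :
  frame_locality F (fwd (op s r)) =
  inclusion F (srel s fle ∘ frel) (frel ∘ srel r fle).
Proof. now destruct s, r. Qed.

Lemma frame_locality_bwd L (F : unimodal_frame L) s r :
  frame_locality F (bwd (adjoint (op s r))) =
  inclusion F (frel ∘ srel r fle) (srel s fle ∘ frel).
Proof. now destruct s, r. Qed.

Section ComplexAlgebra.
Variables (S : signature) (F : unimodal_frame (modals S)).
Let C := complex_algebra S F.
Implicit Types (s r : sign) (u v w x y z : F) (a b c : C).

Lemma complex_ext a b : (forall u, mem u a <-> mem u b) -> a = b.
Proof.
  destruct a as [a Ha], b as [b Hb]. unfold mem; cbn. intros H.
  assert (a = b) as <-.
  { apply functional_extensionality. intros u.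
    now apply propositional_extensionality. }
  now rewrite (proof_irrelevance _ Ha Hb).
Qed.

Lemma complex_lattice : bounded_distributive_lattice C.
Proof.
  split; intros; apply complex_ext; intros u; unfold mem; cbn;
    unfold mem; cbn; tauto.
Qed.

Lemma world_prime u : prime (fun a : C => mem u a).
Proof. unfold prime, mem; cbn. tauto. Qed.

(** Reading worlds as points makes the lemmas on [smem] available in complex algebras. *)
Definition world_point u : point C := Point (world_prime u).

Lemma complex_smem_ext s a b :
  (forall u, smem s (world_point u) a <-> smem s (world_point u) b) -> a = b.
Proof.
  intros H. apply complex_ext. intros u. specialize (H u).
  destruct s; cbn in H; [exact H|].
  split; intros Hu; apply NNPP; tauto.
Qed.

Lemma complex_sle s a b :
  sle s a b <-> forall u, smem s (world_point u) a -> smem s (world_point u) b.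
Proof.
  split.
  - intros H u. now apply (smem_le complex_lattice).
  - intros H. apply (sle_meet complex_lattice), (complex_smem_ext s).
    intros u. rewrite smem_meet. specialize (H u). tauto.
Qed.

Lemma fle_refl u : fle u u.
Proof. apply (ord_refl _ _ (fle_order F)). Qed.

Lemma srel_refl s u : srel s fle u u.
Proof. destruct s; apply fle_refl. Qed.

Lemma srel_trans s u v w : srel s fle u v -> srel s fle v w -> srel s fle u w.
Proof.
  pose proof (ord_trans _ _ (fle_order F)) as T.
  destruct s; cbn; [apply T|]. intros H1 H2. exact (T _ _ _ H2 H1).
Qed.

Lemma smem_srel s u v a :
  srel s fle u v -> smem s (world_point u) a -> smem s (world_point v) a.
Proof.
  destruct s; cbn; intros uv.
  - apply (proj2_sig a _ _ uv).
  - intros Hu Hv. apply Hu. exact (proj2_sig a _ _ uv Hv).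
Qed.

(** Non-membership in a diamond is a universal condition, so signs give boxes and diamonds the same
    clause. *)
Lemma complex_smem_generated s r (h : modals S (op s r)) a u :
  smem s (world_point u) (modal C _ h a) <->
  forall v, generated_rel fle frel (op s r) u v -> smem r (world_point v) a.
Proof.
  destruct s, r; cbn; unfold mem; cbn.
  - reflexivity.
  - reflexivity.
  - split.
    + intros H v uv. apply NNPP. intros Hv. apply H. now exists v.
    + intros H (v & Hv & uv). exact (Hv (H v uv)).
  - split.
    + intros H v uv Hv. apply H. now exists v.
    + intros H (v & Hv & uv). exact (H v uv Hv).
Qed.

(** The last order step of the generated relation is absorbed because [a] is an upset. *)
Lemma complex_smem_modal s r (h : modals S (op s r)) a u :
  smem s (world_point u) (modal C _ h a) <->
  forall x y, srel s fle u x -> frel x y -> smem r (world_point y) a.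
Proof.
  rewrite complex_smem_generated, generated_relE. split.
  - intros H x y ux xy. apply H. exists y. split; [now exists x|].
    apply srel_refl.
  - intros H v (y & (x & ux & xy) & yv). apply (smem_srel _ _ _ _ yv). eauto.
Qed.

Lemma complex_smem_simp s (i : has_simp S s) a b u :
  smem s (world_point u) (simp s i a b) <->
  forall w, srel s fle u w ->
    smem s (world_point w) a -> smem s (world_point w) b.
Proof.
  destruct s; cbn; unfold mem; cbn; unfold mem.
  - reflexivity.
  - split.
    + intros H w wu Ha Hb. apply H. exists w. tauto.
    + intros H (w & wu & Hb & Ha). exact (H w wu Ha Hb).
Qed.

Theorem complex_signed_axioms L' : local_frame L' F -> signed_axioms L' C.
Proof.
  intros loc. split.
  - apply complex_lattice.
  - intros s r h a b. apply (complex_smem_ext s). intros u.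
    rewrite smem_meet, !complex_smem_modal. setoid_rewrite smem_meet.
    firstorder.
  - intros s r h. apply (complex_smem_ext s). intros u.
    rewrite complex_smem_modal. split; intros; apply smem_top.
  - intros s r h k a b. apply complex_sle. intros u.
    rewrite smem_meet, !complex_smem_modal. intros [Ha Hab] x y ux xy.
    specialize (Ha x y ux xy). specialize (Hab x y ux xy).
    rewrite smem_opp in Ha. rewrite smem_join in Hab. tauto.
  (* The hypothesis is used at [x], which is above [u] and sees [y] through [frel] itself. Either
     [x] is in [modal k a] and [h] yields the claim at [y], or it is not and [k] yields it. *)
  - intros s r h k a c H. apply complex_sle. intros u Hc.
    apply complex_smem_modal. intros x y ux xy.
    rewrite complex_sle in H. specialize (H x). rewrite smem_meet in H.
    destruct (classic (smem s (world_point x) (modal C _ k a))) as [Hk|Hk].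
    + apply (proj1 (complex_smem_modal _ _ h a x)) with x; trivial.
      * apply H. split; [exact Hk|]. now apply (smem_srel _ _ _ _ ux).
      * apply srel_refl.
    + apply smem_opp in Hk.
      apply (proj1 (complex_smem_modal _ _ k a x) Hk x); trivial.
      apply srel_refl.
  - intros s r h k a b c H. apply complex_sle. intros u.
    rewrite smem_meet, !complex_smem_modal. intros [Hab Hc] x y ux xy.
    specialize (Hab x y ux xy). apply smem_join in Hab as [Ha|Hb]; [exact Ha|].
    rewrite complex_sle in H. specialize (H x). rewrite smem_meet in H.
    destruct (classic (smem s (world_point x) (modal C _ k b))) as [Hk|Hk].
    + apply (proj1 (complex_smem_modal _ _ h a x)) with x; trivial.
      * apply H. split; [exact Hk|]. now apply (smem_srel _ _ _ _ ux).
      * apply srel_refl.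
    + apply smem_opp in Hk.
      pose proof (proj1 (complex_smem_modal _ _ k b x) Hk x y
        (srel_refl _ _) xy) as Hy.
      apply smem_opp in Hy. contradiction.
  - intros s i a b c. rewrite !complex_sle. split.
    + intros H u. rewrite smem_meet. intros [Ha Hc].
      apply (proj1 (complex_smem_simp _ i a b u) (H u Hc)); [|exact Ha].
      apply srel_refl.
    + intros H u Hc. apply complex_smem_simp. intros w uw Ha.
      apply H, smem_meet. split; [exact Ha|]. now apply (smem_srel _ _ _ _ uw).
  - intros s r Hm h k a b. apply loc in Hm. rewrite frame_locality_fwd in Hm.
    apply complex_sle. intros u Hab. apply smem_join.
    destruct (classic (smem s (world_point u) (modal C _ k b))) as [Hk|Hk];
      [now right|left].
    apply complex_smem_modal. intros x y ux xy.
    (* Locality replaces the path from [u] up to [x] and on to [y] by one leaving [u] directly, so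
       that both modalities are evaluated at [u]. *)
    destruct (Hm u y) as (z & uz & zy); [now exists x|].
    apply (smem_srel _ _ _ _ zy).
    rewrite complex_smem_modal in Hab.
    specialize (Hab u z (srel_refl _ _) uz). apply smem_join in Hab.
    apply smem_opp in Hk.
    pose proof (proj1 (complex_smem_modal _ _ k b u) Hk u z
      (srel_refl _ _) uz) as Hz.
    rewrite smem_opp in Hz. tauto.
  - intros s r Hm h k a. apply loc in Hm. rewrite frame_locality_fwd in Hm.
    apply complex_sle. intros u _. apply smem_join.
    destruct (classic (smem s (world_point u) (modal C _ k a))) as [Hk|Hk];
      [now right|left].
    apply complex_smem_modal. intros x y ux xy.
    destruct (Hm u y) as (z & uz & zy); [now exists x|].
    apply (smem_srel _ _ _ _ zy). apply smem_opp in Hk.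
    exact (proj1 (complex_smem_modal _ _ k a u) Hk u z (srel_refl _ _) uz).
  - intros s r Hm h k i j a b. apply loc in Hm. rewrite frame_locality_bwd in Hm.
    apply complex_sle. intros u Hu. apply complex_smem_modal. intros x y ux xy.
    apply complex_smem_simp. intros z yz Ha.
    (* Locality moves the order step from behind [frel] to before it: some [x'] above [x] sees [z]
       directly. *)
    destruct (Hm x z) as (x' & xx' & x'z); [now exists y|].
    assert (ux' : srel s fle u x') by now apply srel_trans with x.
    apply (proj1 (complex_smem_modal _ _ h b x')) with x';
      [|apply srel_refl|exact x'z].
    apply (proj1 (complex_smem_simp _ i _ _ u) Hu _ ux').
    apply NNPP. intros Hk. apply smem_opp in Hk.
    pose proof (proj1 (complex_smem_modal _ _ k a x') Hk x' z
      (srel_refl _ _) x'z) as Hz.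
    apply smem_opp in Hz. contradiction.
  - intros s r Hm h k j a. apply loc in Hm. rewrite frame_locality_bwd in Hm.
    apply complex_sle. intros u Hu. apply complex_smem_modal. intros x y ux xy.
    apply complex_smem_simp. intros z yz Ha.
    destruct (Hm x z) as (x' & xx' & x'z); [now exists y|].
    assert (ux' : srel s fle u x') by now apply srel_trans with x.
    pose proof (proj1 (complex_smem_modal _ _ k a u) Hu x' z ux' x'z) as Hz.
    apply smem_opp in Hz. contradiction.
Qed.

End ComplexAlgebra.

(** * The canonical frame *)

Lemma local_has_simp (L : fmod -> bool) (L' : modality -> bool) s r :
  L' (bwd (adjoint (op s r))) -> L (op s r) -> L (op (opp s) (opp r)) ->
  has_simp (local_signature L L') s /\ has_simp (local_signature L L') r.
Proof.
  intros Hm h k.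
  (* The sign for which the opposite of the backward symbol has base [op (opp s) (opp r)]. *)
  pose (t := match s, r with pos, pos | neg, neg => pos | _, _ => neg end).
  assert (E : in_force L L' (bwd (adjoint (op s r))) t).
  { unfold in_force. rewrite Hm.
    destruct s, r; cbn in h, k |- *; now rewrite h, k. }
  destruct s, r; cbn [has_simp local_signature has_imp has_coimp] in *;
    split; apply requiresP; eexists; exists t; (split; [exact E|reflexivity]).
Qed.

Lemma local_has_simp_inner (L : fmod -> bool) (L' : modality -> bool) s r :
  L' (bwd (adjoint (op s r))) -> L (op s r) -> L (op s (opp r)) ->
  has_simp (local_signature L L') r.
Proof.
  intros Hm h k.
  (* Here the base of the opposite symbol has to be [op s (opp r)]. *)
  pose (t := match s, r with pos, pos | neg, neg => neg | _, _ => pos end).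
  assert (E : in_force L L' (bwd (adjoint (op s r))) t).
  { unfold in_force. rewrite Hm.
    destruct s, r; cbn in h, k |- *; now rewrite h, k. }
  destruct s, r; cbn [has_simp local_signature has_imp has_coimp] in *;
    apply requiresP; eexists; exists t; (split; [exact E|reflexivity]).
Qed.

Lemma op_surj m : exists s r, m = op s r.
Proof.
  destruct m as [[]|[]];
    [exists pos, pos|exists pos, neg|exists neg, neg|exists neg, pos]; reflexivity.
Qed.

Section Canonical.
Variables (L : fmod -> bool) (L' : modality -> bool).
Variable A : algebra (local_signature L L').
Hypothesis HA : signed_axioms L' A.
Implicit Types (s r : sign) (a b c d : A) (u v w : point A).

Let lat : bounded_distributive_lattice A := sa_lattice HA.

(** Inequalities are tested at all points, where meets and joins become conjunctions and
    disjunctions. *)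
Ltac lattice :=
  apply (sle_points lat);
  let w := fresh "w" in
  intros w;
  repeat match goal with
    H : sle _ _ _ |- _ =>
      pose proof (smem_le lat w H); clear H
  end;
  rewrite ?smem_meet, ?smem_join in *; tauto.

(** * Extending the modalities to all signs *)

Lemma smeet_stop s a : smeet s (stop s) a = a.
Proof.
  rewrite (smeetC lat). apply (sle_meet lat), (sle_stop lat).
Qed.

Lemma smeet_sbot s a : smeet s (sbot s) a = sbot s.
Proof. apply (sle_meet lat), (sbot_sle lat). Qed.

Lemma sjoin_sbot s a : sjoin s (sbot s) a = a.
Proof. apply smeet_stop. Qed.

Lemma stop_opp_opp s : @stop _ A (opp (opp s)) = stop s.
Proof. now rewrite oppK. Qed.

(* A modality outside the signature is interpreted by the least
   meet-preserving map, whose canonical relation holds between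
   any two points. *)
Definition modal_ext s r a : A :=
  match Sumbool.sumbool_of_bool (L (op s r)) with
  | left h => modal A (op s r) h a
  | right _ =>
      if excluded_middle_informative (a = stop r) then stop s else sbot s
  end.

Lemma modal_extE s r (h : L (op s r)) a : modal_ext s r a = modal A (op s r) h a.
Proof.
  unfold modal_ext. destruct (Sumbool.sumbool_of_bool _) as [k|k].
  - now rewrite (proof_irrelevance _ k h).
  - exfalso. unfold is_true in h. congruence.
Qed.

Lemma modal_ext_cases s r :
  (exists h : L (op s r), forall a, modal_ext s r a = modal A (op s r) h a) \/
  (forall a, a = stop r /\ modal_ext s r a = stop s \/
             a <> stop r /\ modal_ext s r a = sbot s).
Proof.
  unfold modal_ext. destruct (Sumbool.sumbool_of_bool _) as [h|h].
  - left. now exists h.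
  - right. intros a. destruct (excluded_middle_informative _); tauto.
Qed.

Lemma modal_ext_top s r : modal_ext s r (stop r) = stop s.
Proof.
  destruct (modal_ext_cases s r) as [[h E]|E].
  - rewrite E. apply (sa_top HA).
  - destruct (E (stop r)); tauto.
Qed.

Lemma modal_ext_meet s r a b :
  modal_ext s r (smeet r a b) = smeet s (modal_ext s r a) (modal_ext s r b).
Proof.
  destruct (modal_ext_cases s r) as [[h E]|E].
  - rewrite !E. apply (sa_meet HA).
  - destruct (E a) as [[-> Ea]|[na Ea]].
    + now rewrite Ea, !smeet_stop.
    + rewrite Ea, smeet_sbot. destruct (E (smeet r a b)) as [[e _]|[_ e]]; [|exact e].
      destruct na. apply (sle_antisym lat r); [apply (sle_stop lat)|].
      rewrite <- e. apply (smeet_l lat).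
Qed.

Lemma modal_ext_mono s r a b :
  sle r a b -> sle s (modal_ext s r a) (modal_ext s r b).
Proof.
  rewrite !(sle_meet lat). intros H. now rewrite <- modal_ext_meet, H.
Qed.

Lemma modal_ext_mono_opp s r a b :
  sle r a b -> sle s (modal_ext (opp s) (opp r) a) (modal_ext (opp s) (opp r) b).
Proof. intros H. apply sle_opp, modal_ext_mono, sle_opp, H. Qed.

Lemma modal_ext_anti_outer s r a b :
  sle r a b -> sle s (modal_ext (opp s) r b) (modal_ext (opp s) r a).
Proof. intros H. apply sle_opp, modal_ext_mono, H. Qed.

Lemma modal_ext_anti_inner s r a b :
  sle r a b -> sle s (modal_ext s (opp r) b) (modal_ext s (opp r) a).
Proof. intros H. apply modal_ext_mono, sle_opp, H. Qed.

Arguments modal_ext_mono s {r a b}.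
Arguments modal_ext_mono_opp s {r a b}.
Arguments modal_ext_anti_outer s {r a b}.
Arguments modal_ext_anti_inner s {r a b}.

Section Present.
Variables (s r : sign).
Hypothesis h : L (op s r).

(** If the second modality is present, this is the axiom. Otherwise its value is the least or the
    greatest element and the inequality degenerates; the next four lemmas follow the same
    pattern. *)
Lemma ext_uni1 a b :
  sle s (smeet s (modal_ext s (opp r) a) (modal_ext s r (sjoin r a b)))
    (modal_ext s r b).
Proof.
  destruct (modal_ext_cases s (opp r)) as [[k E]|E].
  - rewrite E, !(modal_extE _ _ h). apply (sa_uni1 HA).
  - destruct (E a) as [[-> ->]|[_ ->]].
    + rewrite smeet_stop, sjoin_sbot. apply (sle_refl lat).
    + rewrite smeet_sbot. apply (sbot_sle lat).
Qed.

Lemma ext_uni2 a c :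
  sle s (smeet s (modal_ext (opp s) r a) c) (modal_ext s r a) ->
  sle s c (modal_ext s r a).
Proof.
  destruct (modal_ext_cases (opp s) r) as [[k E]|E].
  - rewrite E, !(modal_extE _ _ h). apply (sa_uni2 HA).
  - destruct (E a) as [[-> _]|[_ ->]].
    + intros _. rewrite modal_ext_top. apply (sle_stop lat).
    + now rewrite stop_opp_opp, smeet_stop.
Qed.

Lemma ext_uni3 a b c :
  sle s (smeet s (modal_ext (opp s) (opp r) b) c) (modal_ext s r a) ->
  sle s (smeet s (modal_ext s r (sjoin r a b)) c) (modal_ext s r a).
Proof.
  destruct (modal_ext_cases (opp s) (opp r)) as [[k E]|E].
  - rewrite E, !(modal_extE _ _ h). apply (sa_uni3 HA).
  - destruct (E b) as [[-> _]|[_ ->]].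
    + intros _. rewrite (smeetC lat (opp r)), sjoin_sbot. apply (smeet_l lat).
    + rewrite stop_opp_opp, smeet_stop. intros H.
      apply (sle_trans lat) with c; [apply (smeet_r lat)|exact H].
Qed.

Lemma ext_fwd_opp (Hm : L' (fwd (op s r))) a b :
  sle s (modal_ext s r (sjoin r a b))
    (sjoin s (modal_ext s r a) (modal_ext (opp s) (opp r) b)).
Proof.
  destruct (modal_ext_cases (opp s) (opp r)) as [[k E]|E].
  - rewrite E, !(modal_extE _ _ h). now apply (sa_fwd_opp HA).
  - destruct (E b) as [[-> _]|[_ ->]].
    + rewrite (smeetC lat (opp r)), sjoin_sbot. apply (sjoin_l lat).
    + rewrite stop_opp_opp.
      apply (sle_trans lat) with (stop s); [apply (sle_stop lat)|apply (sjoin_r lat)].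
Qed.

Lemma ext_fwd_same (Hm : L' (fwd (op s r))) a :
  sle s (stop s) (sjoin s (modal_ext s r a) (modal_ext (opp s) r a)).
Proof.
  destruct (modal_ext_cases (opp s) r) as [[k E]|E].
  - rewrite E, !(modal_extE _ _ h). now apply (sa_fwd_same HA).
  - destruct (E a) as [[-> _]|[_ ->]].
    + rewrite modal_ext_top. apply (sjoin_l lat).
    + rewrite stop_opp_opp. apply (sjoin_r lat).
Qed.

(* The backward equations in a form that does not mention implication, so
   that it also holds when the opposite modality is absent. *)
Lemma ext_bwd_opp (Hm : L' (bwd (adjoint (op s r)))) a b c :
  sle s (smeet s (modal_ext (opp s) (opp r) a) c) (modal_ext s r b) ->
  exists d, sle r (smeet r a d) b /\ sle s c (modal_ext s r d).
Proof.
  destruct (modal_ext_cases (opp s) (opp r)) as [[k E]|E].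
  - rewrite E, (modal_extE _ _ h). intros H.
    destruct (local_has_simp L L' s r Hm h k) as [i j].
    exists (simp r j a b). split.
    + apply (sa_residuated HA r j), (sle_refl lat).
    + rewrite (modal_extE _ _ h).
      eapply (sle_trans lat); [|now apply (sa_bwd_opp HA _ _ Hm h k i)].
      now apply (sa_residuated HA s i).
  - destruct (E a) as [[-> _]|[_ ->]].
    + intros _. exists (stop r). rewrite smeet_sbot, modal_ext_top.
      split; [apply (sbot_sle lat)|apply (sle_stop lat)].
    + rewrite stop_opp_opp, smeet_stop. intros H. exists b.
      split; [apply (smeet_r lat)|exact H].
Qed.

(** The witness stands for the [r]-signed pseudocomplement of [a]. It is that residual when
    [op s (opp r)] is present, and an extreme element otherwise. *)
Lemma ext_bwd_same (Hm : L' (bwd (adjoint (op s r)))) a :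
  exists d, sle r (smeet r a d) (sbot r) /\
    sle s (modal_ext s (opp r) a) (modal_ext s r d).
Proof.
  destruct (modal_ext_cases s (opp r)) as [[k E]|E].
  - pose proof (local_has_simp_inner L L' s r Hm h k) as j.
    exists (simp r j a (sbot r)). split.
    + apply (sa_residuated HA r j), (sle_refl lat).
    + rewrite E, (modal_extE _ _ h). now apply (sa_bwd_same HA).
  - destruct (E a) as [[-> _]|[_ ->]].
    + exists (stop r). rewrite smeet_sbot, !modal_ext_top.
      split; apply (sle_refl lat).
    + exists (sbot r). split; [apply (smeet_r lat)|apply (sbot_sle lat)].
Qed.

End Present.

(** * Canonical relations and their generation *)

Definition modal_rel s r u v : Prop :=
  forall a, smem s u (modal_ext s r a) -> smem r v a.

(** All four sign pairs may be included, since the relation of an absent modality is total. *)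
Definition canonical_rel u v : Prop := forall s r, modal_rel s r u v.

Lemma modal_rel_mono s r u u' v v' :
  ple s u u' -> modal_rel s r u' v' -> ple r v' v -> modal_rel s r u v.
Proof. intros H1 H2 H3 a Ha. now apply H3, H2, H1. Qed.

Lemma modal_rel_absent s r u v : ~ L (op s r) -> modal_rel s r u v.
Proof.
  intros no a. destruct (modal_ext_cases s r) as [[h _]|E]; [contradiction|].
  destruct (E a) as [[-> _]|[_ ->]]; intros H.
  - apply smem_top.
  - now apply smem_bot in H.
Qed.

(** The other three relations, rewritten through membership in [u] of sign [s] and in [v] of sign
    [r], so that later arguments keep a single pair of signs. *)
Lemma canonical_rel_signs s r u v :
  modal_rel s r u v ->
  (forall a, smem s u (modal_ext s (opp r) a) -> ~ smem r v a) ->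
  (forall a, ~ smem r v a -> smem s u (modal_ext (opp s) r a)) ->
  (forall a, smem r v a -> smem s u (modal_ext (opp s) (opp r) a)) ->
  canonical_rel u v.
Proof.
  intros H1 H2 H3 H4.
  assert (K2 : modal_rel s (opp r) u v).
  { intros a Ha. apply smem_opp. auto. }
  assert (K3 : modal_rel (opp s) r u v).
  { intros a Ha. apply smem_opp in Ha. apply NNPP. auto. }
  assert (K4 : modal_rel (opp s) (opp r) u v).
  { intros a Ha. apply smem_opp. apply smem_opp in Ha. auto. }
  intros s' r'. destruct s, s', r, r'; assumption.
Qed.

Arguments canonical_rel_signs s r {u v}.

(** A point extends this base exactly if it is a [modal_rel s r] successor of [u]. *)
Lemma box_directed s r u : directed r (fun a => smem s u (modal_ext s r a)).
Proof.
  split.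
  - exists (stop r). rewrite modal_ext_top. apply smem_top.
  - intros a b Ha Hb. exists (smeet r a b). split.
    + rewrite modal_ext_meet. now apply smem_meet.
    + split; [apply (smeet_l lat)|apply (smeet_r lat)].
Qed.

Lemma maximal_pair s r u v : modal_rel s r u v ->
  exists u' v', ple s u u' /\ ple r v' v /\ modal_rel s r u' v' /\
    forall u'' v'', ple s u' u'' -> ple r v'' v' -> modal_rel s r u'' v'' ->
      ple s u'' u' /\ ple r v' v''.
Proof.
  intros uv.
  pose (T := {p : point A * point A |
    ple s u (fst p) /\ ple r (snd p) v /\ modal_rel s r (fst p) (snd p)}).
  pose (le (p q : T) := ple s (fst (proj1_sig p)) (fst (proj1_sig q)) /\
    ple r (snd (proj1_sig q)) (snd (proj1_sig p))).
  assert (t0 : T).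
  { exists (u, v). split; [apply ple_refl|]. split; [apply ple_refl|exact uv]. }
  destruct (@zorn_preorder T t0 le) as [[[u' v'] (Hu & Hv & Huv)] max].
  - intros p. split; apply ple_refl.
  - intros p q t [pq1 pq2] [qt1 qt2].
    split; [exact (ple_trans pq1 qt1)|exact (ple_trans qt2 pq2)].
  - intros C [p0 Cp0] chain.
    destruct (@chain_limit _ A s
      (fun x => exists p, C p /\ x = fst (proj1_sig p))) as [u1 Hu1].
    { eauto. }
    { intros ? ? (p & Cp & ->) (q & Cq & ->).
      destruct (chain p q Cp Cq) as [[H _]|[H _]]; auto. }
    (* Second coordinates descend in the [r]-order, so their limit is taken in the opposite sign. *)
    destruct (@chain_limit _ A (opp r)
      (fun x => exists p, C p /\ x = snd (proj1_sig p))) as [v1 Hv1].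
    { eauto. }
    { intros ? ? (p & Cp & ->) (q & Cq & ->). rewrite !ple_opp.
      destruct (chain p q Cp Cq) as [[_ H]|[_ H]]; auto. }
    assert (Ku : forall p, C p -> ple s (fst (proj1_sig p)) u1).
    { intros p Cp a Ha. apply Hu1. exists (fst (proj1_sig p)). eauto. }
    assert (Kv : forall p, C p -> ple r v1 (snd (proj1_sig p))).
    { intros p Cp. apply ple_opp. intros a Ha. apply Hv1.
      exists (snd (proj1_sig p)). eauto. }
    assert (H1 : ple s u u1 /\ ple r v1 v /\ modal_rel s r u1 v1).
    { pose proof (proj2_sig p0) as (K1 & K2 & _). split; [|split].
      - exact (ple_trans K1 (Ku p0 Cp0)).
      - exact (ple_trans (Kv p0 Cp0) K2).
      (* Membership at [u1] is witnessed by some [p] and non-membership at [v1] by some [q]; the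
         later of the two would violate its own [modal_rel]. *)
      - intros a Ha. apply NNPP. intros Hn. apply smem_opp in Hn.
        apply Hu1 in Ha as (? & (p & Cp & ->) & Ha).
        apply Hv1 in Hn as (? & (q & Cq & ->) & Hn).
        apply smem_opp in Hn. apply Hn.
        destruct (chain p q Cp Cq) as [[H _]|[_ H]].
        + apply (proj2_sig q), H, Ha.
        + apply H, (proj2_sig p), Ha. }
    exists (exist _ (u1, v1) H1). intros p Cp. split; [apply Ku|apply Kv]; exact Cp.
  - exists u', v'. split; [exact Hu|]. split; [exact Hv|]. split; [exact Huv|].
    intros u'' v'' uu vv H.
    assert (H' : ple s u u'' /\ ple r v'' v /\ modal_rel s r u'' v'').
    { split; [exact (ple_trans Hu uu)|]. split; [exact (ple_trans vv Hv)|exact H]. }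
    apply (max (exist _ (u'', v'') H')). split; assumption.
Qed.

Lemma modal_rel_generated s r (h : L (op s r)) u v : modal_rel s r u v ->
  exists u' v', ple s u u' /\ canonical_rel u' v' /\ ple r v' v.
Proof.
  intros uv. destruct (maximal_pair uv) as (x & y & ux & yv & xy & max).
  exists x, y. split; [exact ux|]. split; [|exact yv].
  (* Minimality of [y]: without such an [a], separation would give a successor [z] of [x] strictly
     below [y], omitting [b]. *)
  assert (miny : forall b, smem r y b ->
    exists a, ~ smem r y a /\ smem s x (modal_ext s r (sjoin r b a))).
  { intros b Hb. apply NNPP. intros no.
    destruct (@prime_separation _ A lat r (fun a => smem s x (modal_ext s r a))
      (fun c => exists a, ~ smem r y a /\ c = sjoin r b a)) as (z & Hz1 & Hz2).
    - apply box_directed.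
    - split.
      + exists (sjoin r b (sbot r)), (sbot r). split; [apply smem_bot|reflexivity].
      + intros ? ? (a & Ha & ->) (a' & Ha' & ->).
        exists (sjoin r b (sjoin r a a')). split; [|split].
        * exists (sjoin r a a'). split; [rewrite smem_join; tauto|reflexivity].
        * apply sle_opp. lattice.
        * apply sle_opp. lattice.
    - intros c ? Hc (a & Ha & ->) H. apply no. exists a. split; [exact Ha|].
      apply (smem_le lat x (modal_ext_mono s H) Hc).
    - destruct (max x z) as [_ yz].
      + apply ple_refl.
      + intros a Ha. apply NNPP. intros Hn. apply (Hz2 (sjoin r b a)).
        * now exists a.
        * apply smem_join. now right.
      + exact Hz1.
      + apply (Hz2 (sjoin r b (sbot r))).
        * exists (sbot r). split; [apply smem_bot|reflexivity].
        * apply smem_join. left. now apply yz. }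
  (* Maximality of [x]: otherwise separation would give a predecessor of [y] above [x] containing
     [d]. *)
  assert (maxx : forall d, ~ smem s x d ->
    exists c a, smem s x c /\ ~ smem r y a /\
      sle s (smeet s d c) (modal_ext s r a)).
  { intros d Hd. apply NNPP. intros no.
    destruct (@prime_separation _ A lat s
      (fun b => exists c, smem s x c /\ b = smeet s d c)
      (fun b => exists a, ~ smem r y a /\ b = modal_ext s r a)) as (z & Hz1 & Hz2).
    - split.
      + exists (smeet s d (stop s)), (stop s). split; [apply smem_top|reflexivity].
      + intros ? ? (c & Hc & ->) (c' & Hc' & ->).
        exists (smeet s d (smeet s c c')). split; [|split].
        * exists (smeet s c c'). split; [now apply smem_meet|reflexivity].
        * lattice.
        * lattice.
    - split.
      + exists (modal_ext s r (sbot r)), (sbot r).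
        split; [apply smem_bot|reflexivity].
      + intros ? ? (a & Ha & ->) (a' & Ha' & ->).
        exists (modal_ext s r (sjoin r a a')). split; [|split].
        * exists (sjoin r a a'). split; [rewrite smem_join; tauto|reflexivity].
        * apply sle_opp, modal_ext_mono, (sjoin_l lat).
        * apply sle_opp, modal_ext_mono, (sjoin_r lat).
    - intros ? ? (c & Hc & ->) (a & Ha & ->) H. apply no. now exists c, a.
    - assert (Hz : forall c, smem s x c -> smem s z (smeet s d c)).
      { intros c Hc. apply Hz1. now exists c. }
      destruct (max z y) as [zx _].
      + intros c Hc. now apply Hz, smem_meet in Hc.
      + apply ple_refl.
      + intros a Ha. apply NNPP. intros Hn. apply (Hz2 (modal_ext s r a)).
        * now exists a.
        * exact Ha.
      + apply Hd, zx. pose proof (Hz _ (smem_top s x)) as K.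
        now apply smem_meet in K. }
  apply (canonical_rel_signs s r); [exact xy|..].
  - intros a Ha Hy. destruct (miny a Hy) as (b & Hb & Hx). apply Hb, xy.
    apply (smem_le lat x (ext_uni1 s r h a b)), smem_meet. now split.
  (* Passing from [a] and [b] to their join makes both sides of [H] speak of the same element, as
     [ext_uni2] demands. The join then lies in [y] although [a] and [b] do not. *)
  - intros a Ha. apply NNPP. intros Hx.
    destruct (maxx _ Hx) as (c & b & Hc & Hb & H).
    enough (smem r y (sjoin r a b)) as K by (apply smem_join in K; tauto).
    apply xy. apply (smem_le lat x) with c; [|exact Hc].
    apply (ext_uni2 s r h).
    pose proof (modal_ext_anti_outer s (sjoin_l lat r a b)).
    pose proof (modal_ext_mono s (sjoin_r lat r a b)).
    lattice.
  (* Here [c], [a] come from [maxx] and [a'] from [miny]; [ext_uni3] at the join of [a] and [a']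
     forces this join into [y]. *)
  - intros b Hb. apply NNPP. intros Hx.
    destruct (maxx _ Hx) as (c & a & Hc & Ha & H).
    destruct (miny b Hb) as (a' & Ha' & Hx').
    enough (smem r y (sjoin r a a')) as K by (apply smem_join in K; tauto).
    apply xy.
    apply (smem_le lat x) with
      (smeet s (modal_ext s r (sjoin r (sjoin r a a') b)) c).
    + apply (ext_uni3 s r h).
      pose proof (modal_ext_mono s (sjoin_l lat r a a')). lattice.
    + apply smem_meet. split; [|exact Hc].
      apply (smem_le lat x) with (modal_ext s r (sjoin r b a')); [|exact Hx'].
      apply modal_ext_mono. lattice.
Qed.

(** * Locality of the canonical relation *)

Lemma canonical_fwd s r (h : L (op s r)) (Hm : L' (fwd (op s r))) u v' :
  modal_rel s r u v' -> exists v, canonical_rel u v /\ ple r v v'.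
Proof.
  intros uv.
  (* The ideal collects what [v] must omit: [c] and [b] for two of the canonical relations, and [a]
     to keep [v] below [v']. *)
  destruct (@prime_separation _ A lat r (fun a => smem s u (modal_ext s r a))
    (fun d => exists c a b, smem s u (modal_ext s (opp r) c) /\ ~ smem r v' a /\
      ~ smem s u (modal_ext (opp s) (opp r) b) /\
      d = sjoin r c (sjoin r a b))) as (v & Hv1 & Hv2).
  - apply box_directed.
  - assert (Kc : smem s u (modal_ext s (opp r) (sbot r))).
    { rewrite modal_ext_top. apply smem_top. }
    assert (Kb : ~ smem s u (modal_ext (opp s) (opp r) (sbot r))).
    { rewrite modal_ext_top. apply smem_bot. }
    split.
    + exists (sjoin r (sbot r) (sjoin r (sbot r) (sbot r))),
        (sbot r), (sbot r), (sbot r).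
      auto using smem_bot.
    + intros ? ? (c & a & b & Hc & Ha & Hb & ->)
        (c' & a' & b' & Hc' & Ha' & Hb' & ->).
      exists (sjoin r (sjoin r c c') (sjoin r (sjoin r a a') (sjoin r b b'))).
      split; [|split; apply sle_opp; lattice].
      do 3 eexists. split; [|split; [|split; [|reflexivity]]].
      * rewrite modal_ext_meet. now apply smem_meet.
      * rewrite smem_join. tauto.
      * rewrite modal_ext_meet, smem_join. tauto.
  (* Disjointness: [ext_uni1] cancels [c], and [ext_fwd_opp] splits the join of [a] and [b]. *)
  - intros x ? Hx (c & a & b & Hc & Ha & Hb & ->) H. apply Ha, uv.
    assert (K : smem s u (modal_ext s r (sjoin r a b))).
    { apply (smem_le lat u (ext_uni1 s r h c _)), smem_meet.
      split; [exact Hc|]. exact (smem_le lat u (modal_ext_mono s H) Hx). }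
    apply (smem_le lat u (ext_fwd_opp s r h Hm a b)), smem_join in K. tauto.
  - assert (Kc : smem s u (modal_ext s (opp r) (sbot r))).
    { rewrite modal_ext_top. apply smem_top. }
    assert (Kb : ~ smem s u (modal_ext (opp s) (opp r) (sbot r))).
    { rewrite modal_ext_top. apply smem_bot. }
    assert (K : forall c a b, smem s u (modal_ext s (opp r) c) -> ~ smem r v' a ->
      ~ smem s u (modal_ext (opp s) (opp r) b) ->
      ~ smem r v c /\ ~ smem r v a /\ ~ smem r v b).
    { intros c a b Hc Ha Hb.
      assert (K : ~ smem r v (sjoin r c (sjoin r a b))).
      { apply Hv2. now exists c, a, b. }
      rewrite !smem_join in K. tauto. }
    exists v. split.
    + apply (canonical_rel_signs s r).
      * exact Hv1.
      * intros c Hc. pose proof (K c (sbot r) (sbot r) Hc (@smem_bot _ _ r v')). tauto.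
      * intros a Ha.
        pose proof (smem_le lat u (ext_fwd_same s r h Hm a) (smem_top s u)) as Ku.
        apply smem_join in Ku as [Ku|Ku]; [|exact Ku].
        destruct Ha. now apply Hv1.
      * intros b Hb. apply NNPP. intros Hn.
        pose proof (K (sbot r) (sbot r) b Kc (@smem_bot _ _ r v') Hn). tauto.
    + intros a Ha. apply NNPP. intros Hn.
      pose proof (K (sbot r) a (sbot r) Kc Hn Kb). tauto.
Qed.

Lemma canonical_bwd s r (h : L (op s r)) (Hm : L' (bwd (adjoint (op s r)))) u0 v :
  modal_rel s r u0 v -> exists u, ple s u0 u /\ canonical_rel u v.
Proof.
  intros uv.
  (* With [v] fixed, the filter collects [u0] and the values that [canonical_rel_signs] requires in
     [u], the ideal those that it requires outside. *)
  destruct (@prime_separation _ A lat s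
    (fun d => exists c b a, smem s u0 c /\ smem r v b /\ ~ smem r v a /\
      d = smeet s c (smeet s (modal_ext (opp s) (opp r) b) (modal_ext (opp s) r a)))
    (fun d => exists a b, ~ smem r v a /\ smem r v b /\
      d = sjoin s (modal_ext s r a) (modal_ext s (opp r) b)))
    as (u & Hu1 & Hu2).
  - split.
    + exists (smeet s (stop s) (smeet s (modal_ext (opp s) (opp r) (stop r))
        (modal_ext (opp s) r (sbot r)))), (stop s), (stop r), (sbot r).
      auto using smem_top, smem_bot.
    + intros ? ? (c & b & a & Hc & Hb & Ha & ->)
        (c' & b' & a' & Hc' & Hb' & Ha' & ->).
      pose proof (modal_ext_mono_opp s (smeet_l lat r b b')).
      pose proof (modal_ext_mono_opp s (smeet_r lat r b b')).
      pose proof (modal_ext_anti_outer s (sjoin_l lat r a a')).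
      pose proof (modal_ext_anti_outer s (sjoin_r lat r a a')).
      eexists. split; [|split].
      * exists (smeet s c c'), (smeet r b b'), (sjoin r a a').
        rewrite !smem_meet, smem_join.
        split; [|split; [|split; [|reflexivity]]]; tauto.
      * lattice.
      * lattice.
  - split.
    + exists (sjoin s (modal_ext s r (sbot r)) (modal_ext s (opp r) (stop r))),
        (sbot r), (stop r).
      auto using smem_top, smem_bot.
    + intros ? ? (a & b & Ha & Hb & ->) (a' & b' & Ha' & Hb' & ->).
      pose proof (modal_ext_mono s (sjoin_l lat r a a')).
      pose proof (modal_ext_mono s (sjoin_r lat r a a')).
      pose proof (modal_ext_anti_inner s (smeet_l lat r b b')).
      pose proof (modal_ext_anti_inner s (smeet_r lat r b b')).
      eexists. split; [|split].
      * exists (sjoin r a a'), (smeet r b b').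
        rewrite smem_join, smem_meet.
        split; [|split; [|reflexivity]]; tauto.
      * apply sle_opp. lattice.
      * apply sle_opp. lattice.
  (* Let [d] be the pseudocomplement of [b'], and let [e] join [a], [a'] and [d], all outside [v].
     [ext_uni2] at [e] removes the value at [a], and [ext_bwd_opp] then yields [g] in [v] whose meet
     with [b] is below [e]: a contradiction. *)
  - intros ? ? (c & b & a & Hc & Hb & Ha & ->) (a' & b' & Ha' & Hb' & ->) H.
    destruct (ext_bwd_same s r h Hm b') as (d & Hd & Hd').
    assert (Kd : ~ smem r v d).
    { intros Kd. apply (@smem_bot _ _ r v), (smem_le lat v Hd), smem_meet.
      now split. }
    pose (e := sjoin r a (sjoin r a' d)).
    assert (Ke : ~ smem r v e).
    { unfold e. rewrite !smem_join. tauto. }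
    assert (ae : sle r a e) by (unfold e; lattice).
    assert (a'e : sle r a' e) by (unfold e; lattice).
    assert (de : sle r d e) by (unfold e; lattice).
    clearbody e.
    destruct (ext_bwd_opp s r h Hm b e c) as (g & Hg & Hg').
    + apply (ext_uni2 s r h).
      pose proof (modal_ext_anti_outer s ae).
      pose proof (modal_ext_mono s a'e). pose proof (modal_ext_mono s de).
      clear ae a'e de Hd. lattice.
    + apply Ke, (smem_le lat v Hg), smem_meet. split; [exact Hb|].
      apply uv, (smem_le lat u0 Hg'), Hc.
  - assert (K : forall c b a, smem s u0 c -> smem r v b -> ~ smem r v a ->
      smem s u c /\ smem s u (modal_ext (opp s) (opp r) b) /\
      smem s u (modal_ext (opp s) r a)).
    { intros c b a Hc Hb Ha. rewrite <- !smem_meet. apply Hu1. now exists c, b, a. }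
    assert (K' : forall a b, ~ smem r v a -> smem r v b ->
      ~ smem s u (modal_ext s r a) /\ ~ smem s u (modal_ext s (opp r) b)).
    { intros a b Ha Hb.
      assert (Kj : ~ smem s u (sjoin s (modal_ext s r a) (modal_ext s (opp r) b))).
      { apply Hu2. now exists a, b. }
      rewrite smem_join in Kj. tauto. }
    exists u. split.
    + intros c Hc.
      pose proof (K c (stop r) (sbot r) Hc (smem_top r v) (@smem_bot _ _ r v)).
      tauto.
    + apply (canonical_rel_signs s r).
      * intros a Ha. apply NNPP. intros Hn.
        pose proof (K' a (stop r) Hn (smem_top r v)). tauto.
      * intros b Hb Hn. pose proof (K' (sbot r) b (@smem_bot _ _ r v) Hn). tauto.
      * intros a Ha.
        pose proof (K (stop s) (stop r) a (smem_top s u0) (smem_top r v) Ha). tauto.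
      * intros b Hb.
        pose proof (K (stop s) b (sbot r) (smem_top s u0) Hb (@smem_bot _ _ r v)). tauto.
Qed.

(** * The canonical frame *)

Lemma srel_ple s u v : srel s (ple pos) u v <-> ple s u v.
Proof. destruct s; [reflexivity|]. symmetry. apply (ple_opp pos). Qed.

Lemma canonical_generated s r u v :
  generated_rel (ple pos) canonical_rel (op s r) u v -> modal_rel s r u v.
Proof.
  rewrite generated_relE. intros (y & (x & ux & xy) & yv).
  rewrite srel_ple in ux, yv. exact (modal_rel_mono ux (xy s r) yv).
Qed.

Lemma modal_rel_canonical s r (h : L (op s r)) u v :
  modal_rel s r u v -> generated_rel (ple pos) canonical_rel (op s r) u v.
Proof.
  intros uv. destruct (modal_rel_generated h uv) as (x & y & ux & xy & yv).
  rewrite generated_relE. exists y. rewrite srel_ple. split; [|exact yv].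
  exists x. now rewrite srel_ple.
Qed.

Lemma canonical_order : order (point A) (ple pos).
Proof.
  split.
  - intros u. apply ple_refl.
  - intros u v w. apply ple_trans.
  - intros u v uv vu. apply point_ext. intros a. split; [apply uv|apply vu].
Qed.

(** For present modalities the generated relation coincides with [modal_rel]; the absent ones impose
    no constraint. *)
Lemma canonical_inter u v :
  canonical_rel u v <->
  forall m, L m -> generated_rel (ple pos) canonical_rel m u v.
Proof.
  split.
  - intros uv m h. destruct (op_surj m) as (s & r & ->).
    now apply modal_rel_canonical.
  - intros H s r. destruct (classic (L (op s r))) as [h|h].
    + now apply canonical_generated, H.
    + now apply modal_rel_absent.
Qed.

Definition canonical_frame : unimodal_frame L :=
  @UnimodalFrame L _ _ _ canonical_order canonical_inter.

Lemma canonical_local :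
  (forall m, L' m -> L (base m)) -> local_frame L' canonical_frame.
Proof.
  intros HL' m Hm. pose proof (HL' m Hm) as h.
  destruct m as [m|m].
  - destruct (op_surj m) as (s & r & ->). rewrite frame_locality_fwd.
    intros u v (x & ux & xv). apply srel_ple in ux.
    destruct (@canonical_fwd s r h Hm u v) as (y & uy & yv).
    + exact (modal_rel_mono ux (xv s r) (ple_refl _ v)).
    + exists y. split; [exact uy|]. now apply srel_ple.
  - destruct (op_surj (adjoint m)) as (s & r & E).
    assert (m = adjoint (op s r)) as -> by (rewrite <- E; now destruct m as [[]|[]]).
    assert (k : L (op s r)) by (rewrite <- E; exact h).
    rewrite frame_locality_bwd.
    intros u v (x & ux & xv). apply srel_ple in xv.
    destruct (@canonical_bwd s r k Hm u v) as (y & uy & yv).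
    + exact (modal_rel_mono (ple_refl _ u) (ux s r) xv).
    + exists y. split; [|exact yv]. now apply srel_ple.
Qed.

Local Notation C := (complex_algebra (local_signature L L') canonical_frame).

(** * The Stone embedding into the complex algebra *)

Definition canonical_map a : C :=
  exist (@is_upset (local_signature L L') canonical_frame) (fun u => u a)
    (fun u v (uv : ple pos u v) => uv a).

Lemma smem_canonical_map s u a :
  smem s (@world_point (local_signature L L') canonical_frame u)
    (canonical_map a) <-> smem s u a.
Proof. now destruct s. Qed.

Lemma canonical_map_inj a b : canonical_map a = canonical_map b -> a = b.
Proof.
  intros E.
  assert (K : forall u, smem pos u a <-> smem pos u b).
  { intros u. now rewrite <- !smem_canonical_map, E. }
  apply (sle_antisym lat pos); apply (sle_points lat); apply K.
Qed.

Lemma canonical_map_smeet s a b :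
  canonical_map (smeet s a b) = smeet s (canonical_map a) (canonical_map b).
Proof.
  apply (complex_smem_ext s). intros u.
  rewrite smem_meet, !smem_canonical_map. apply smem_meet.
Qed.

Lemma canonical_map_stop s : canonical_map (stop s) = stop s.
Proof.
  apply (complex_smem_ext s). intros u. rewrite smem_canonical_map.
  split; intros; apply smem_top.
Qed.

Lemma canonical_map_simp s (i : has_simp (local_signature L L') s) a b :
  canonical_map (simp s i a b) = simp s i (canonical_map a) (canonical_map b).
Proof.
  apply (complex_smem_ext s). intros u.
  rewrite complex_smem_simp, smem_canonical_map. split.
  - intros H w uw. rewrite !smem_canonical_map. intros Ha.
    apply srel_ple in uw.
    apply (smem_le lat w) with (smeet s a (simp s i a b)).
    + apply (sa_residuated HA s i), (sle_refl lat).
    + apply smem_meet. split; [exact Ha|]. now apply uw.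
  - intros H. apply NNPP. intros Hn.
    (* If the residual is not in [u], separating the meets of [a] with members of [u] from [b] gives
       a point above [u] that contains [a] and omits [b]. *)
    destruct (@prime_separation _ A lat s
      (fun d => exists c, smem s u c /\ d = smeet s a c) (eq b)) as (w & Hw & Hb).
    + split.
      * exists (smeet s a (stop s)), (stop s). split; [apply smem_top|reflexivity].
      * intros ? ? (c & Hc & ->) (c' & Hc' & ->).
        exists (smeet s a (smeet s c c')). split; [|split; lattice].
        exists (smeet s c c'). split; [now apply smem_meet|reflexivity].
    + apply (directed_singleton lat).
    + intros ? ? (c & Hc & ->) <- K. apply Hn.
      apply (sa_residuated HA s i) in K. exact (smem_le lat u K Hc).
    + assert (K : forall c, smem s u c -> smem s w a /\ smem s w c).
      { intros c Hc. apply smem_meet, Hw. now exists c. }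
      apply (Hb b eq_refl). rewrite <- smem_canonical_map. apply H.
      * apply srel_ple. intros c Hc. now apply K.
      * apply smem_canonical_map. now apply (K (stop s)), smem_top.
Qed.

Lemma canonical_map_modal s r (h : L (op s r)) a :
  canonical_map (modal A (op s r) h a) = modal C (op s r) h (canonical_map a).
Proof.
  apply (complex_smem_ext s). intros u.
  rewrite smem_canonical_map, complex_smem_generated, <- modal_extE. split.
  - intros H v uv. apply smem_canonical_map.
    now apply (canonical_generated _ _ _ _ uv).
  - intros H. apply NNPP. intros Hn.
    (* A [modal_rel] successor of [u] omitting [a]; [modal_rel_canonical] makes it a successor in
       the generated relation. *)
    destruct (@prime_separation _ A lat r
      (fun b => smem s u (modal_ext s r b)) (eq a)) as (v & Hv & Ha).
    + apply box_directed.
    + apply (directed_singleton lat).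
    + intros x ? Hx <- K. apply Hn. exact (smem_le lat u (modal_ext_mono s K) Hx).
    + apply (Ha a eq_refl). rewrite <- smem_canonical_map.
      apply H, modal_rel_canonical; assumption.
Qed.

Lemma eval_canonical_map (v : nat -> A) t :
  eval C (fun n => canonical_map (v n)) t = canonical_map (eval A v t).
Proof.
  induction t as [n| | |t1 IH1 t2 IH2|t1 IH1 t2 IH2|i t1 IH1 t2 IH2
    |j t1 IH1 t2 IH2|m h t IH]; cbn [eval]; rewrite ?IH1, ?IH2, ?IH.
  - reflexivity.
  - symmetry. exact (canonical_map_stop neg).
  - symmetry. exact (canonical_map_stop pos).
  - symmetry. exact (canonical_map_smeet pos _ _).
  - symmetry. exact (canonical_map_smeet neg _ _).
  - symmetry. exact (canonical_map_simp pos i _ _).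
  - symmetry. exact (canonical_map_simp neg j _ _).
  - symmetry. destruct (op_surj m) as (s & r & ->).
    exact (canonical_map_modal s r h _).
Qed.

(** Injectivity lets equations be reflected as well as preserved, which carries over to all Boolean
    combinations. *)
Lemma holds_canonical_map (v : nat -> A) p :
  holds C (fun n => canonical_map (v n)) p <-> holds A v p.
Proof.
  induction p as [t1 t2| |p IHp q IHq|p IHp q IHq|p IHp q IHq]; cbn [holds];
    try tauto.
  rewrite !eval_canonical_map. split; [apply canonical_map_inj|congruence].
Qed.

End Canonical.

Theorem mainTheorem12 (L : fmod -> bool) (L' : modality -> bool)
    (HL' : forall m : modality, L' m -> L (base m)) :
  generated_as_universal_class
    (@local_unimodal_algebra L L') (@local_complex_algebra L L').
Proof.
  split; [|split].
  - apply local_unimodal_universal.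
  - intros A (F & HF & ->). apply signed_axiomsP.
    exact (@complex_signed_axioms (local_signature L L') F L' HF).
  (* Each formula of [T] holds in the complex algebra of the canonical frame and descends to [A]
     along the embedding. *)
  - intros K [T HT] HG A HA. apply signed_axiomsP in HA. apply HT. intros p Tp v.
    apply (holds_canonical_map HA).
    apply HT; [|exact Tp]. apply HG. exists (canonical_frame HA).
    split; [|reflexivity]. now apply canonical_local.
Qed.
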